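(* Let $(M,g)$ be a compact connected pseudo-Kähler manifold with complex-structure tensor $J$, such that the complex manifold $M$ has the $\partial\overline{\partial}$ property, and let $v$ be an affine vector field on $(M,g)$. Treat $TM$ as a complex vector bundle, with multiplication by $i$ given by $J$. Then the $(0,2)$ tensor field $\mathcal{L}_v g$ is the real part of a holomorphic section $\theta$ of the second complex symmetric power of the complex dual of $TM$. Consequently, $\mathcal{L}_v g=0$ if the second complex symmetric power of the complex dual of $TM$ admits no nonzero holomorphic section on $M$.
   Context: All manifolds and tensor fields are smooth; manifolds are connected. A pseudo-Kähler manifold is a pseudo-Riemannian manifold $(M,g)$ (the metric $g$ need not be definite) endowed with an almost-complex structure $J$ which is parallel for the Levi-Civita connection $\nabla$ of $g$ and makes $g$ Hermitian, i.e. $g(J\cdot,J\cdot)=g$. Then $J$ is integrable, so $M$ is a complex manifold. A compact complex manifold $M$ has the $\partial\overline{\partial}$ property if, for all integers $p,q\ge 0$, every closed complex-valued $(p,q)$-form on $M$ that is $\partial$-exact or $\overline{\partial}$-exact equals $\partial\overline{\partial}\lambda$ for some $(p-1,q-1)$-form $\lambda$ (in particular it is zero if $p=0$ or $q=0$). A vector field $v$ on $(M,g)$ is affine if its local flow preserves the Levi-Civita connection $\nabla$ of $g$ (equivalently $\mathcal{L}_v\nabla=0$, with $\mathcal{L}_v$ the Lie derivative). A section $\theta$ of the second complex symmetric power of the complex dual of $TM$ is a symmetric complex-valued tensor field on $TM$ that is complex-bilinear at each point, i.e. $\theta(Jw,w')=i\,\theta(w,w')=\theta(w,Jw')$. This bundle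 carries its natural holomorphic structure (induced by identifying $(TM,J)$ with the holomorphic tangent bundle); $\theta$ is holomorphic if and only if $\theta(w,w')$ is a holomorphic function for all local real-holomorphic vector fields $w,w'$ (those with $\mathcal{L}_wJ=\mathcal{L}_{w'}J=0$). Such holomorphic sections are called holomorphic quadratic differentials. *)

(* Defs.v *)
From HB Require Import structures.
From mathcomp Require Import all_boot all_order all_algebra.
From mathcomp Require Import all_classical all_reals topology normedtype derive.
From mathcomp Require Import complex.

Set Implicit Arguments.
Unset Strict Implicit.
Unset Printing Implicit Defensive.

Import Order.TTheory GRing.Theory Num.Theory.
Import numFieldNormedType.Exports.

Local Open Scope classical_set_scope.
Local Open Scope ring_scope.

Section SmoothOn.
Context {R : realType} {n : nat}.
Implicit Types (U : set 'rV[R]_n) (f g : 'rV[R]_n -> R).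

(* Only meaningful for open [U]: the partial derivatives are those of the total
   function [f]. *)
Fixpoint Ck_on k U f : Prop :=
  {in U, continuous f} /\
  if k is k'.+1 then
    forall i : 'I_n, let e : 'rV[R]_n := delta_mx ord0 i in
      (forall x, U x -> derivable f x e) /\ Ck_on k' U ('D_e f)
  else True.

Definition smooth_on U f := forall k, Ck_on k U f.

Lemma near_openE U f g x : open U -> (forall y, U y -> f y = g y) -> U x ->
  \forall y \near x, f y = g y.
Proof. by move=> oU fg Ux; apply: filterS (open_nbhs_nbhs (conj oU Ux)). Qed.

Lemma eq_continuous_in U f g : open U -> (forall x, U x -> f x = g x) ->
  {in U, continuous f} -> {in U, continuous g}.
Proof.
move=> oU fg cf x xU; have Ux : U x by rewrite inE in xU.
rewrite /continuous_at -(fg _ Ux); apply: cvg_trans (cf x xU).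
by apply: (@near_eq_cvg _ _ (nbhs x)); exact: (near_openE oU fg Ux).
Qed.

Lemma eq_Ck_on k U f g : open U -> (forall x, U x -> f x = g x) ->
  Ck_on k U f -> Ck_on k U g.
Proof.
move=> oU; elim: k f g => [|k IH] f g fg [cf df].
  split=> //; exact: eq_continuous_in oU fg cf.
split; first exact: eq_continuous_in oU fg cf.
move=> i; have [dfi Ci] := df i; split=> [x Ux|].
  exact: (near_eq_derivable (near_openE oU fg Ux) (dfi x Ux)).
by apply: IH Ci => x Ux; apply: near_eq_derive; exact: (near_openE oU fg Ux).
Qed.

Lemma Ck_onS k U f : Ck_on k.+1 U f -> Ck_on k U f.
Proof.
elim: k f => [|k IH] f [cf df]; split=> // i.
by have [dfi Ci] := df i; split=> //; exact: IH.
Qed.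

Lemma Ck_on_cst k U c : Ck_on k U (cst c).
Proof.
have cc b : {in U, continuous (cst b : 'rV[R]_n -> R)}.
  by move=> x _; exact: cst_continuous.
elim: k c => [|k IH] c; split=> // i; split=> [x _|]; first exact: derivable_cst.
have -> : 'D_(delta_mx ord0 i) (cst c : 'rV[R]_n -> R) = cst 0.
  by apply/funext => x; rewrite derive_cst.
exact: IH.
Qed.

Lemma Ck_onD k U f g : open U ->
  Ck_on k U f -> Ck_on k U g -> Ck_on k U (f + g).
Proof.
have cD (h l : 'rV[R]_n -> R) : {in U, continuous h} -> {in U, continuous l} ->
    {in U, continuous (h + l)}.
  by move=> ch cl x Ux; apply: continuousD; [exact: ch | exact: cl].
move=> oU; elim: k f g => [|k IH] f g [cf df] [cg dg]; first by split=> //; exact: cD.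
split; first exact: cD.
move=> i; have [dfi Ci] := df i; have [dgi Di] := dg i.
split=> [x Ux|]; first by apply: derivableD; [exact: dfi | exact: dgi].
apply: eq_Ck_on (IH _ _ Ci Di) => // x Ux.
by rewrite deriveD; [|exact: dfi | exact: dgi].
Qed.

Lemma Ck_onM k U f g : open U ->
  Ck_on k U f -> Ck_on k U g -> Ck_on k U (f * g).
Proof.
have cM (h l : 'rV[R]_n -> R) : {in U, continuous h} -> {in U, continuous l} ->
    {in U, continuous (h * l)}.
  by move=> ch cl x Ux; apply: continuousM; [exact: ch | exact: cl].
move=> oU; elim: k f g => [|k IH] f g Cf Cg; have [cf df] := Cf;
  have [cg dg] := Cg; first by split=> //; exact: cM.
split=> [|i]; first exact: cM.
have [dfi Ci] := df i; have [dgi Di] := dg i.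
split=> [x Ux|]; first by apply: derivableM; [exact: dfi | exact: dgi].
have := Ck_onD oU (IH _ _ (Ck_onS Cf) Di) (IH _ _ (Ck_onS Cg) Ci).
apply: eq_Ck_on => // x Ux.
by rewrite deriveM; [|exact: dfi | exact: dgi].
Qed.

End SmoothOn.

Section Manifold.
Variables (R : realType) (n : nat).

Record chart (M : topologicalType) := Chart {
  cdom : set M;
  cmap : M -> 'rV[R]_n;
  cinv : 'rV[R]_n -> M;
  cdom_open : open cdom;
  cimg_open : open (cmap @` cdom);
  cmapK : {in cdom, cancel cmap cinv};
  cmap_continuous : {in cdom, continuous cmap};
  cinv_continuous : {in cmap @` cdom, continuous cinv} }.

Record manifold := Manifold {
  carrier :> topologicalType;
  manifold_hausdorff : hausdorff_space carrier;
  manifold_second_countable : @second_countable carrier;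
  atlas : set (chart carrier);
  atlas_cover : forall p, exists2 c, atlas c & cdom c p;
  atlas_compatible : forall c d, atlas c -> atlas d ->
    forall k : 'I_n, smooth_on (cmap c @` (cdom c `&` cdom d))
                               (fun y => cmap d (cinv c y) ord0 k) }.

End Manifold.

Arguments atlas {R n} m _.

Section Functions.
Context {R : realType} {n : nat} (M : manifold R n).

Definition smooth (f : M -> R) :=
  forall c, atlas M c -> smooth_on (cmap c @` cdom c) (f \o cinv c).

Definition smooth_pred : {pred M -> R} := fun f => `[< smooth f >].

Lemma smooth_cst a : smooth (cst a).
Proof. by move=> c _ k; exact: Ck_on_cst. Qed.

Lemma smoothD f g : smooth f -> smooth g -> smooth (f + g).
Proof.
by move=> sf sg c Ac k; apply: Ck_onD (sf c Ac k) (sg c Ac k); exact: cimg_open.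
Qed.

Lemma smoothM f g : smooth f -> smooth g -> smooth (f * g).
Proof.
by move=> sf sg c Ac k; apply: Ck_onM (sf c Ac k) (sg c Ac k); exact: cimg_open.
Qed.

Lemma smoothZ a f : smooth f -> smooth (a *: f).
Proof. exact: (smoothM (smooth_cst a)). Qed.

Lemma smoothB f g : smooth f -> smooth g -> smooth (f - g).
Proof. by move=> sf sg; rewrite -scaleN1r; apply/smoothD/smoothZ. Qed.

Lemma smooth_subring_closed : subring_closed smooth_pred.
Proof.
split=> [|f g|f g]; first by apply/asboolP; exact: smooth_cst.
  by move=> /asboolP sf /asboolP sg; apply/asboolP; exact: smoothB.
by move=> /asboolP sf /asboolP sg; apply/asboolP; exact: smoothM.
Qed.

Lemma smooth_submod_closed : subsemimod_closed smooth_pred.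
Proof.
split; first split; first by apply/asboolP; exact: smooth_cst.
  by move=> f g /asboolP sf /asboolP sg; apply/asboolP; exact: smoothD.
by move=> a f /asboolP sf; apply/asboolP; exact: smoothZ.
Qed.

Record sfun := SFun { sf :> M -> R; sfP : sf \in smooth_pred }.

HB.instance Definition _ := [isSub for sf].
HB.instance Definition _ := [Choice of sfun by <:].
HB.instance Definition _ :=
  GRing.SubChoice_isSubComPzRing.Build (M -> R) smooth_pred sfun
    smooth_subring_closed.
HB.instance Definition _ :=
  GRing.SubZmodule_isSubLmodule.Build R (M -> R) smooth_pred sfun
    smooth_submod_closed.

Definition csmooth (f : M -> R[i]) :=
  smooth (fun p => complex.Re (f p)) /\ smooth (fun p => complex.Im (f p)).

Definition csmooth_pred : {pred M -> R[i]} := fun f => `[< csmooth f >].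

Lemma csmooth_submod_closed : subsemimod_closed csmooth_pred.
Proof.
split; first split.
- by apply/asboolP; split; exact: smooth_cst.
- move=> f g /asboolP[f1 f2] /asboolP[g1 g2]; apply/asboolP.
  split.
    have -> : (fun p => complex.Re ((f + g) p)) =
        (fun p => complex.Re (f p)) + (fun p => complex.Re (g p)).
      by apply/funext => p; rewrite /= !fctE; case: (f p) (g p) => ? ? [].
    exact: smoothD.
  have -> : (fun p => complex.Im ((f + g) p)) =
      (fun p => complex.Im (f p)) + (fun p => complex.Im (g p)).
    by apply/funext => p; rewrite /= !fctE; case: (f p) (g p) => ? ? [].
  exact: smoothD.
- move=> [a b] f /asboolP[f1 f2]; apply/asboolP; split.
    have -> : (fun p => complex.Re (((a +i* b)%C *: f) p)) =
        a *: (fun p => complex.Re (f p)) - b *: (fun p => complex.Im (f p)).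
      by apply/funext => p; rewrite /= !fctE; case: (f p).
    by apply: smoothB; exact: smoothZ.
  have -> : (fun p => complex.Im (((a +i* b)%C *: f) p)) =
      a *: (fun p => complex.Im (f p)) + b *: (fun p => complex.Re (f p)).
    by apply/funext => p; rewrite /= !fctE; case: (f p).
  by apply: smoothD; exact: smoothZ.
Qed.

Record csfun := CSFun { csf :> M -> R[i]; csfP : csf \in csmooth_pred }.

HB.instance Definition _ := [isSub for csf].
HB.instance Definition _ := [Choice of csfun by <:].
HB.instance Definition _ :=
  GRing.SubChoice_isSubLmodule.Build R[i] (M -> R[i]) csmooth_pred csfun
    csmooth_submod_closed.

Lemma sfun_smooth (f : sfun) : smooth f.
Proof. by apply/asboolP; exact: sfP. Qed.

Lemma csfun_Re (f : csfun) : (fun p => complex.Re (f p)) \in smooth_pred.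
Proof. by have /asboolP[? ?] := csfP f; apply/asboolP. Qed.
Definition re_sfun (f : csfun) : sfun := SFun (csfun_Re f).

Lemma csfun_Im (f : csfun) : (fun p => complex.Im (f p)) \in smooth_pred.
Proof. by have /asboolP[? ?] := csfP f; apply/asboolP. Qed.
Definition im_sfun (f : csfun) : sfun := SFun (csfun_Im f).

Lemma csfun_of_subproof (f g : sfun) :
  (fun p => (f p +i* g p)%C) \in csmooth_pred.
Proof. by apply/asboolP; split; exact: sfun_smooth. Qed.
Definition csfun_of f g : csfun := CSFun (csfun_of_subproof f g).

(* Vector fields as derivations of the algebra of smooth functions; on a
   manifold in the above sense these are exactly the smooth sections of the
   tangent bundle. *)
Record vfield := VField {
  vf :> sfun -> sfun;
  vf_linear : forall (a : R) (f h : sfun), vf (a *: f + h) = a *: vf f + vf h;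
  vf_leibniz : forall f h : sfun, vf (f * h) = vf f * h + f * vf h }.

End Functions.

Section VectorFields.
Context {R : realType} {n : nat} {M : manifold R n}.
Local Notation S := (sfun M).
Local Notation V := (vfield M).
Implicit Types (f h : S) (X Y : V).

HB.instance Definition _ := gen_eqMixin V.
HB.instance Definition _ := gen_choiceMixin V.

Lemma sfun_eqP f h : (forall p, f p = h p) -> f = h.
Proof. by move=> fh; apply/val_inj/funext. Qed.

Lemma sfun_scaleM (a : R) f h : (a *: f) * h = a *: (f * h).
Proof. by apply: sfun_eqP => p; rewrite /= -[LHS]mulrA. Qed.

Lemma sfun_scaleMr (a : R) f h : f * (a *: h) = a *: (f * h).
Proof. by rewrite mulrC sfun_scaleM mulrC. Qed.

Lemma vfield_eqP X Y : (forall f, X f = Y f) -> X = Y.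
Proof.
case: X Y => [x lx Lx] [y ly Ly] /= xy.
have {xy} e : x = y by apply/funext.
by subst y; congr VField; exact: Prop_irrelevance.
Qed.

Fact vzero_linear (a : R) f h : 0 = a *: 0 + 0 :> S.
Proof. by rewrite scaler0 addr0. Qed.
Fact vzero_leibniz f h : 0 = 0 * h + f * 0 :> S.
Proof. by rewrite mul0r mulr0 addr0. Qed.
Definition vzero : V := VField vzero_linear vzero_leibniz.

Fact vopp_linear X (a : R) f h : - X (a *: f + h) = a *: - X f - X h.
Proof. by rewrite vf_linear opprD scalerN. Qed.
Fact vopp_leibniz X f h : - X (f * h) = - X f * h + f * - X h.
Proof. by rewrite vf_leibniz opprD mulNr mulrN. Qed.
Definition vopp X : V := VField (vopp_linear X) (vopp_leibniz X).

Fact vadd_linear X Y (a : R) f h :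
  X (a *: f + h) + Y (a *: f + h) = a *: (X f + Y f) + (X h + Y h).
Proof. by rewrite !vf_linear scalerDr addrACA. Qed.
Fact vadd_leibniz X Y f h :
  X (f * h) + Y (f * h) = (X f + Y f) * h + f * (X h + Y h).
Proof. by rewrite !vf_leibniz mulrDl mulrDr addrACA. Qed.
Definition vadd X Y : V := VField (vadd_linear X Y) (vadd_leibniz X Y).

Fact vscale_linear u X (a : R) f h :
  u * X (a *: f + h) = a *: (u * X f) + u * X h.
Proof. by rewrite vf_linear mulrDr sfun_scaleMr. Qed.
Fact vscale_leibniz u X f h : u * X (f * h) = u * X f * h + f * (u * X h).
Proof. by rewrite vf_leibniz mulrDr mulrA (mulrCA u). Qed.
Definition vscale u X : V := VField (vscale_linear u X) (vscale_leibniz u X).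

Program Definition vfield_zmod := @GRing.isZmodule.Build V vzero vopp vadd _ _ _ _.
Next Obligation. by move=> X Y Z; apply: vfield_eqP => f; exact: addrA. Qed.
Next Obligation. by move=> X Y; apply: vfield_eqP => f; exact: addrC. Qed.
Next Obligation. by move=> X; apply: vfield_eqP => f; exact: add0r. Qed.
Next Obligation. by move=> X; apply: vfield_eqP => f; exact: addNr. Qed.
HB.instance Definition _ := vfield_zmod.

Program Definition vfield_lmod :=
  @GRing.Zmodule_isLmodule.Build S V vscale _ _ _ _.
Next Obligation. by move=> u w X; apply: vfield_eqP => f; exact: mulrA. Qed.
Next Obligation. by move=> X; apply: vfield_eqP => f; exact: mul1r. Qed.
Next Obligation. by move=> u X Y; apply: vfield_eqP => f; exact: mulrDr. Qed.
Next Obligation. by move=> X u w; apply: vfield_eqP => f; exact: mulrDl. Qed.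
HB.instance Definition _ := vfield_lmod.

Fact bracket_linear X Y (a : R) f h :
  X (Y (a *: f + h)) - Y (X (a *: f + h)) =
  a *: (X (Y f) - Y (X f)) + (X (Y h) - Y (X h)).
Proof. by rewrite !vf_linear scalerBr opprD addrACA. Qed.
Fact vfD X f h : X (f + h) = X f + X h.
Proof. by rewrite -[f in LHS]scale1r vf_linear scale1r. Qed.
Fact bracket_aux (W : zmodType) (a b c d a' d' : W) :
  (a + b) + (c + d) - ((a' + c) + (b + d')) = (a - a') + (d - d').
Proof.
rewrite (addrC c d) (addrACA a) (addrC b d') (addrACA a') (addrC c b).
by rewrite opprD [LHS]addrACA subrr addr0 opprD addrACA.
Qed.
Fact bracket_leibniz X Y f h :
  X (Y (f * h)) - Y (X (f * h)) =
  (X (Y f) - Y (X f)) * h + f * (X (Y h) - Y (X h)).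
Proof.
by rewrite !vf_leibniz !vfD !vf_leibniz mulrBl mulrBr; exact: bracket_aux.
Qed.
Definition bracket X Y : V := VField (bracket_linear X Y) (bracket_leibniz X Y).

Definition cderiv X (F : csfun M) : csfun M :=
  csfun_of (X (re_sfun F)) (X (im_sfun F)).

End VectorFields.

(* Tensor fields are given by their [sfun M]-multilinear action on global vector
   fields, and their values at a point by evaluating the resulting function. *)

Section PseudoKahler.
Context {R : realType} {n : nat} {M : manifold R n}.
Local Notation S := (sfun M).
Local Notation V := (vfield M).
Implicit Types (u : S) (X Y Z v w : V).

(* The value of [X] at the point [p] is the derivation [fun f => X f p]. *)
Definition vanishes_at X (p : M) := forall f, X f p = 0.

Record is_pseudo_riemannian (g : V -> V -> S) : Prop := {
  metric_sym : forall X Y, g X Y = g Y X;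
  metric_linear : forall u X Y Z, g (u *: X + Y) Z = u * g X Z + g Y Z;
  metric_nondegenerate : forall X (p : M),
    (forall Y, g X Y p = 0) -> vanishes_at X p }.

Record is_levi_civita (g : V -> V -> S) (D : V -> V -> V) : Prop := {
  connection_linear : forall u X Y Z, D (u *: X + Y) Z = u *: D X Z + D Y Z;
  connection_add : forall X Y Z, D X (Y + Z) = D X Y + D X Z;
  connection_leibniz : forall u X Y, D X (u *: Y) = X u *: Y + u *: D X Y;
  connection_torsion_free : forall X Y, D X Y - D Y X = bracket X Y;
  connection_metric : forall X Y Z, X (g Y Z) = g (D X Y) Z + g Y (D X Z) }.

Record is_pseudo_kahler (g : V -> V -> S) (D : V -> V -> V)
    (J : {linear V -> V}) : Prop := {
  kahler_metric : is_pseudo_riemannian g;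
  kahler_connection : is_levi_civita g D;
  kahler_almost_complex : forall X, J (J X) = - X;
  kahler_hermitian : forall X Y, g (J X) (J Y) = g X Y;
  kahler_parallel : forall X Y, D X (J Y) = J (D X Y) }.

(* The Lie derivative [L_v D] vanishes, i.e. the local flow of [v] preserves
   [D]. *)
Definition is_affine (D : V -> V -> V) v :=
  forall X Y, bracket v (D X Y) = D (bracket v X) Y + D X (bracket v Y).

Definition lie_metric v (g : V -> V -> S) X Y : S :=
  v (g X Y) - g (bracket v X) Y - g X (bracket v Y).

End PseudoKahler.

Section Forms.
Context {R : realType} {n : nat} {M : manifold R n}.
Local Notation CS := (csfun M).
Local Notation V := (vfield M).
Variable J : {linear V -> V}.

(* A [k]-form takes a sequence of vector fields, of which it only reads the first
   [k]; forms of all degrees thus share one type. *)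
Definition form := (nat -> V) -> CS.

Record is_form (k : nat) (om : form) : Prop := {
  form_local : forall X Y : nat -> V,
    (forall m, (m < k)%N -> X m = Y m) -> om X = om Y;
  form_linear : forall (X : nat -> V) i (u : sfun M) (Y Z : V) (p : M),
    (i < k)%N ->
    om [eta X with i |-> u *: Y + Z] p =
      (u p)%:C%C * om [eta X with i |-> Y] p + om [eta X with i |-> Z] p;
  form_alternating : forall (X : nat -> V) i j,
    (i < j < k)%N -> X i = X j -> om X = 0 }.

(* Exterior derivative of a [k]-form. In the usual formula the bracket
   [[X_i, X_j]] comes first, with sign [(-1)^(i+j)]; here it stands in the place
   of [X_i], whence the sign [(-1)^j]. *)
Definition extd (k : nat) (om : form) : form := fun X =>
  \sum_(i < k.+1) (-1) ^+ i *: cderiv (X i) (om (X \o bump i)) +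
  \sum_(i < k.+1) \sum_(j < k.+1 | (i < j)%N)
    (-1) ^+ j *: om (fun m => if m == i then bracket (X i) (X j)
                              else X (bump j m)).

Definition twist (k : nat) (T : {set 'I_k}) (X : nat -> V) : nat -> V :=
  fun m => if [exists j in T, val j == m] then J (X m) else X m.

(* Projection of a [(p + q)]-form onto its component of type [(p, q)]: the sum,
   over the sets [A] of [p] arguments, of the complex-multilinear extension of
   [om] evaluated at [(X_m - i J X_m) / 2] for [m] in [A] and at
   [(X_m + i J X_m) / 2] for the other [m], expanded by multilinearity. *)
Definition type_proj (p q : nat) (om : form) : form := fun X =>
  (2 ^+ (p + q))^-1 *:
  \sum_(A : {set 'I_(p + q)} | #|A| == p) \sum_(T : {set 'I_(p + q)})
    ((- 'i%C) ^+ #|T :&: A| * 'i%C ^+ #|T :\: A|) *: om (twist T X).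

Definition is_pqform (p q : nat) (om : form) :=
  is_form (p + q) om /\ type_proj p q om = om.

Definition del (p q : nat) (om : form) : form :=
  type_proj p.+1 q (extd (p + q) om).

Definition delbar (p q : nat) (om : form) : form :=
  type_proj p q.+1 (extd (p + q) om).

(* A form of negative bidegree is zero. *)
Definition del_exact (p q : nat) (om : form) : Prop :=
  if p is p'.+1 then exists2 la, is_pqform p' q la & om = del p' q la
  else om = fun=> 0.

Definition delbar_exact (p q : nat) (om : form) : Prop :=
  if q is q'.+1 then exists2 la, is_pqform p q' la & om = delbar p q' la
  else om = fun=> 0.

Definition deldelbar_exact (p q : nat) (om : form) : Prop :=
  match p, q with
  | p'.+1, q'.+1 =>
      exists2 la, is_pqform p' q' la & om = del p' q'.+1 (delbar p' q' la)
  | _, _ => om = fun=> 0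
  end.

Definition ddbar_property := forall (p q : nat) (om : form),
  is_pqform p q om -> extd (p + q) om = (fun=> 0) ->
  del_exact p q om \/ delbar_exact p q om -> deldelbar_exact p q om.

End Forms.

Section Holomorphic.
Context {R : realType} {n : nat} {M : manifold R n}.
Local Notation CS := (csfun M).
Local Notation V := (vfield M).
Variable J : {linear V -> V}.

Definition holomorphic_on (U : set M) (F : CS) := forall (X : V) (p : M), U p ->
  cderiv (J X) F p = 'i%C * cderiv X F p.

(* The Lie derivative [L_w J] vanishes on [U]. *)
Definition real_holomorphic_on (U : set M) (w : V) := forall (X : V) (p : M),
  U p -> vanishes_at (bracket w (J X) - J (bracket w X)) p.

(* In [quadratic_holomorphic] the vector fields are global and only required to
   be real-holomorphic on [U]: near each point of its domain, a local vector
   field agrees with a global one. *)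
Record is_holomorphic_quadratic (th : V -> V -> CS) : Prop := {
  quadratic_sym : forall X Y, th X Y = th Y X;
  quadratic_linear : forall (u : sfun M) X Y Z (p : M),
    th (u *: X + Y) Z p = (u p)%:C%C * th X Z p + th Y Z p;
  quadratic_complex : forall X Y, th (J X) Y = 'i%C *: th X Y;
  quadratic_holomorphic : forall (U : set M) w w', open U ->
    real_holomorphic_on U w -> real_holomorphic_on U w' ->
    holomorphic_on U (th w w') }.

End Holomorphic.

(* Main.v *)
(* Put [omega := g (J _) _].  As [v] is affine, [eta := L_v omega] and [L_v g]
   are parallel, and [eta = d lambda] with [lambda := g (J v) _] by Cartan's
   formula.  The (2,0)-part of [eta] is the [del] of the (1,0)-part of [lambda]
   and is closed, being parallel; so it vanishes by the del-delbar property, and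
   [eta], which is real, is of type (1,1).  Then [d] of the (0,1)-part of
   [lambda] is a closed (1,1)-form, hence equal to [del (delbar F)] for some
   function [F], and for [f := Im F] the parallel symmetric form
   [b X Y := eta X (J Y)] satisfies [b X X = X X f + JX JX f + (J [X, JX]) f].
   So [b] is nonpositive at a maximum of [f] and nonnegative at a minimum; the
   sign of a parallel symmetric form being the same everywhere, [b = 0], i.e.
   [L_v omega = 0].  This makes [L_v g] anti-Hermitian, hence the real part of
   [theta := L_v g - i (L_v g) (J _) _], which is complex-bilinear and parallel,
   and therefore holomorphic. *)
Require Import Defs.
From HB Require Import structures.
From mathcomp Require Import all_boot all_order all_algebra.
From mathcomp Require Import all_classical all_reals topology normedtype derive landau realfun
  function_spaces sequences exp measure lebesgue_measure lebesgue_integral ftc.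
From mathcomp Require Import complex.
From mathcomp Require Import ring lra.
(* [sfun] would otherwise denote the simple functions of the integration library. *)
Import Defs.

Set Implicit Arguments.
Unset Strict Implicit.
Unset Printing Implicit Defensive.

Import Order.TTheory GRing.Theory Num.Theory.
Import numFieldNormedType.Exports.

Local Open Scope classical_set_scope.
Local Open Scope ring_scope.

(** * Calculus of iterated partial derivatives *)

(** As [g] may be indefinite, it provides no norm with which to conclude that an exact parallel form
    vanishes; the extrema of [f] and the parallelism of [b] take over that role. The two uses of the
    del-delbar property are ordered: only once [eta] is known to be of type (1,1) is [b] symmetric
    and [d] of the (0,1)-part of [lambda] of type (1,1). The real part of [del (delbar F)] involves
    only the imaginary part of [F], whence the choice of [f]. Vector fields are derivations and
    tensors act on global fields, so every pointwise statement is reached through bump functions,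
    and coordinate fields span near a point by Hadamard's lemma; the chart calculus serves this
    purpose. The sign of a parallel form is usually compared at two points by parallel transport,
    that is, by solving a linear differential equation. Here no equation is solved: a weighted
    quadratic form is maximized over a chart segment times a unit sphere, and the derivative at the
    maximum has the wrong sign. *)

Section Line.
Context {R : realType} {V : normedModType R}.
Implicit Types (f : V -> R) (z v : V).

Lemma is_derive_line f z v (s : R) : derivable f (z + s *: v) v ->
  is_derive s 1 (fun t : R => f (z + t *: v)) ('D_v f (z + s *: v)).
Proof.
move=> df; have E : (fun h : R => h^-1 *: (f (z + (h *: 1 + s) *: v) - f (z + s *: v))) =
   (fun h : R => h^-1 *: (f (h *: v + (z + s *: v)) - f (z + s *: v))).
  by apply/funext => h; rewrite scalerDl addrCA /GRing.scale /= mulr1.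
by split; rewrite /derivable /derive/= E.
Qed.

Lemma is_derive_line_scale f z v (c s : R) : derivable f (z + (s * c) *: v) v ->
  is_derive s 1 (fun t : R => f (z + (t * c) *: v)) (c * 'D_v f (z + (s * c) *: v)).
Proof.
move=> /is_derive_line df.
have dg : is_derive s (1 : R) (fun t : R => t * c) c.
  have -> : (fun t : R => t * c) = c *: (id : R -> R).
    by apply/funext => t; rewrite /= mulrC.
  have := @is_deriveZ R R R id c s 1 1 _.
  by rewrite (_ : c *: (1 : R) = c) ?[LHS]mulr1//; apply; exact: is_derive_id.
have := @is_derive1_comp _ (fun t => f (z + t *: v)) ( *%R^~ c) s _ _ df dg.
by rewrite mulrC.
Qed.

(** The segment is parametrized by [0, 1] with speed [c], so that no case distinction on the sign of
    [c] is needed. *)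
Lemma MVT_line f z v (c : R) :
  (forall s : R, 0 <= s <= 1 -> derivable f (z + (s * c) *: v) v) ->
  exists2 s, 0 <= s <= 1 & f (z + c *: v) - f z = c * 'D_v f (z + (s * c) *: v).
Proof.
move=> df.
have dg (s : R) : 0 <= s <= 1 -> is_derive s 1 (fun t : R => f (z + (t * c) *: v))
    (c * 'D_v f (z + (s * c) *: v)).
  by move=> /df /is_derive_line_scale.
have cg : {within `[0 : R, 1], continuous (fun t : R => f (z + (t * c) *: v))}.
  apply: derivable_within_continuous => s; rewrite in_itv /= => /dg ds.
  exact: ex_derive.
have [s] := MVT_segment ler01
  (fun s (h : s \in `]0, 1[) => dg s ltac:(by move: h; rewrite in_itv /= =>
    /andP[/ltW -> /ltW ->])) cg.
rewrite in_itv /= => s01; rewrite mul1r mul0r scale0r addr0 subr0 mulr1 => e.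
by exists s.
Qed.

End Line.

Section Partials.
Context {R : realType} {n : nat}.
Local Notation E := 'rV[R]_n.
Local Notation e_ i := (delta_mx ord0 i : E).
Implicit Types (f : E -> R) (x h : E) (U : set E).

Lemma ler_coord_norm h j : `|h ord0 j| <= `|h|.
Proof.
rewrite [leRHS]/Num.Def.normr /= mx_normrE.
by apply/bigmax_geP; right => /=; exists (ord0, j).
Qed.

Lemma normr_rV_lt h (d : R) : 0 < d -> (forall j, `|h ord0 j| < d) -> `|h| < d.
Proof.
move=> d0 hd; rewrite [ltLHS]/Num.Def.normr /= mx_normrE.
by apply/bigmax_ltP; split=> // -[i j] _ /=; rewrite ord1.
Qed.

Lemma normr_rV_le h (d : R) : 0 <= d -> (forall j, `|h ord0 j| <= d) -> `|h| <= d.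
Proof.
move=> d0 hd; rewrite [leLHS]/Num.Def.normr /= mx_normrE.
by apply/bigmax_leP; split=> // -[i j] _ /=; rewrite ord1.
Qed.

Let part h k : E := \row_i (if (i < k)%N then h ord0 i else 0).

Let partS h (j : 'I_n) : part h j.+1 = part h j + h ord0 j *: e_ j.
Proof.
apply/rowP => i; rewrite !mxE eqxx /= ltnS leq_eqVlt.
rewrite (inj_eq val_inj); case: eqVneq => [->|ij] /=; first by rewrite ltnn add0r mulr1.
by rewrite mulr0 addr0.
Qed.

Lemma increment_partials f x h (d : R) : `|h| < d ->
  (forall y, `|y - x| < d -> forall j, derivable f y (e_ j)) ->
  exists2 y : 'I_n -> E, (forall j, `|y j - x| <= `|h|) &
   f (x + h) - f x = \sum_j h ord0 j * 'D_(e_ j) f (y j).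
Proof.
move=> hd df.
have d0 : 0 < d by apply: le_lt_trans hd.
have bnd (j : 'I_n) (s : R) : 0 <= s <= 1 ->
    `|x + part h j + (s * h ord0 j) *: e_ j - x| <= `|h|.
  move=> /andP[s0 s1]; rewrite -(addrA x) [_ - x]addrC addKr.
  apply: normr_rV_le => // i; rewrite !mxE eqxx /=.
  have := ler_coord_norm h i.
  case: ltnP => [ij|]; first by rewrite (ltn_eqF ij : i == j = false) mulr0 addr0.
  move=> _ hi; rewrite add0r; case: eqVneq => [<-|_].
    by rewrite mulr1 normrM (ger0_norm s0) (le_trans _ hi)// ler_piMl.
  by rewrite mulr0 normr0.
have step (j : 'I_n) : exists y, `|y - x| <= `|h| /\
    f (x + part h j.+1) - f (x + part h j) = h ord0 j * 'D_(e_ j) f y.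
  have [|s s01 e] := @MVT_line R E f (x + part h j) (e_ j) (h ord0 j).
    by move=> s s01; apply: df; apply: le_lt_trans (bnd _ _ s01) hd.
  by exists (x + part h j + (s * h ord0 j) *: e_ j); split; [exact: bnd|rewrite -e partS addrA].
have {step} [y yP] := choice step.
exists y => [j|]; first by have [] := yP j.
under eq_bigr => j _ do rewrite -(proj2 (yP j)).
rewrite -(big_mkord predT (fun j => f (x + part h j.+1) - f (x + part h j))).
rewrite (telescope_sumr (fun j => f (x + part h j)))//; congr (f _ - f _).
  by congr (_ + _); apply/rowP => i; rewrite mxE ltn_ord.
by rewrite [X in _ + X](_ : _ = 0) ?addr0//; apply/rowP => i; rewrite !mxE ltn0.
Qed.

Lemma partials_differentiable f U x : open U -> U x ->
  (forall j y, U y -> derivable f y (e_ j)) ->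
  (forall j, {for x, continuous ('D_(e_ j) f)}) ->
  is_diff x f (fun h => \sum_j h ord0 j * 'D_(e_ j) f x).
Proof.
move=> oU Ux df cdf.
pose L h := \sum_j h ord0 j * 'D_(e_ j) f x.
have linL : linear L.
  move=> a u w; rewrite /L /GRing.scale /= mulr_sumr -big_split /=.
  by apply: eq_bigr => j _; rewrite !mxE mulrDl mulrA.
pose LM := GRing.isLinear.Build _ _ _ _ _ linL.
pose LL : {linear E -> R} := HB.pack L LM.
have cL : continuous LL.
  rewrite /= /L; apply: continuous_big => [|j _ y]; first exact: add_continuous.
  exact: (continuousM (@coord_continuous R 1 n ord0 j y) (@cst_continuous _ _ _ _)).
have exp : f \o shift x = cst (f x) + LL +o_ (0 : E) id.
  apply/eqaddoP => e e0.
  have /nbhs_normP[d /= d0 dU] := open_nbhs_nbhs (conj oU Ux).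
  (* The error is shared among [n] partial derivatives; dividing by [n.+1] also covers [n = 0]. *)
  have e1 : 0 < e / n.+1%:R by rewrite divr_gt0.
  have near1 : \forall y \near x, forall j, `|'D_(e_ j) f y - 'D_(e_ j) f x| <= e / n.+1%:R.
    apply: (@filter_forall _ 'I_n (fun j y => `|'D_(e_ j) f y - 'D_(e_ j) f x| <= e / n.+1%:R)
      (nbhs x) _) => j.
    have /cvgrPdist_le/(_ _ e1) := cdf j.
    by apply: filterS => y; rewrite distrC.
  have /nbhs_normP[d' /= d'0 d'U] := near1.
  have dd0 : 0 < Num.min d d' by rewrite lt_min d0.
  near=> h; have hd : `|h| < Num.min d d' by near: h; exact: (@nbhs0_lt R E _ dd0).
  have [|y yh fE] := @increment_partials f x h _ hd.
    move=> y yd j; apply: df; apply: dU; rewrite /= distrC.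
    by apply: lt_le_trans yd _; rewrite ge_min lexx.
  rewrite !fctE /= (addrC h x) opprD addrA fE /L -sumrB.
  apply: le_trans (ler_norm_sum _ _ _) _.
  apply: (@le_trans _ _ (\sum_(j < n) (e / n.+1%:R * `|h|))).
    apply: ler_sum => j _; rewrite -mulrBr normrM mulrC ler_pM//; last exact: ler_coord_norm.
    apply: d'U; rewrite /= distrC; apply: le_lt_trans (yh j) _.
    by apply: lt_le_trans hd _; rewrite ge_min lexx orbT.
  rewrite sumr_const card_ord -[leLHS]mulr_natl mulrA ler_wpM2r//.
  by rewrite mulrCA ler_piMr ?(ltW e0)//; rewrite ler_pdivrMr// mul1r ler_nat.
have dfE : 'd f x = L :> (E -> R) by exact: (diff_unique cL exp).
by apply: DiffDef => //; apply/diff_locallyP; split; rewrite dfE.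
Unshelve. all: by end_near. Qed.

End Partials.

(** * Directional derivatives as one-variable derivatives, chain rules *)

Section LineDerivative.
Context {R : realType} {V : normedModType R}.

Lemma derivable_lineP (f : V -> R) (x v : V) (l : R) :
  is_derive x v f l <-> is_derive (0 : R) 1 (fun h : R => f (x + h *: v)%R) l.
Proof.
have E : (fun h : R => h^-1 *: (f (x + (h *: (1 : R) + 0) *: v) - f (x + (0 : R) *: v))) =
   (fun h : R => h^-1 *: (f (h *: v + x) - f x)).
  by apply/funext => h; rewrite scale0r !addr0 (addrC x) [h *: (1 : R)]mulr1.
split=> [[d e]|[]]; first by split; rewrite /derivable /derive/= E.
by rewrite /derivable /derive/= E => d e; split.
Qed.

Lemma is_derive_comp1 (psi : R -> R) (u : V -> R)
    (x v : V) (dpsi du : R) :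
  is_derive (u x) 1 psi dpsi -> is_derive x v u du ->
  is_derive x v (psi \o u) (dpsi * du).
Proof.
move=> dp /derivable_lineP d; apply/derivable_lineP.
have dp' : is_derive ((fun h : R => u (x + h *: v)) 0) 1 psi dpsi.
  by rewrite /= scale0r addr0.
exact: (@is_derive1_comp _ psi (fun h : R => u (x + h *: v)) 0 _ _ dp' d).
Qed.

End LineDerivative.

Lemma rV_continuous_at (T : topologicalType) (R : realType) n (tau : T -> 'rV[R]_n) x :
  (forall j, {for x, continuous (fun y => tau y ord0 j)}) -> {for x, continuous tau}.
Proof.
move=> ct; apply/cvgrPdist_le => /= e e0.
have cj : \forall y \near x, forall j, `|tau x ord0 j - tau y ord0 j| <= e.
  apply: (@filter_forall _ 'I_n (fun j y => `|tau x ord0 j - tau y ord0 j| <= e) (nbhs x) _) => j.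
  by have /cvgrPdist_le/(_ _ e0) := ct j.
apply: filterS cj => y yj; apply: normr_rV_le; first exact: ltW.
by move=> j; rewrite !mxE.
Qed.

Section CkOn.
Context {R : realType}.
Local Notation e_ i := (delta_mx ord0 i).

Lemma Ck_on_continuous n k (U : set 'rV[R]_n) f : Ck_on k U f -> {in U, continuous f}.
Proof. by case: k => [|k] []. Qed.

Lemma Ck_on_is_diff n (U : set 'rV[R]_n) f x : open U -> U x -> Ck_on 1 U f ->
  is_diff x f (fun h => \sum_j h ord0 j * 'D_(e_ j) f x).
Proof.
move=> oU Ux [_ df]; apply: (partials_differentiable oU Ux) => [j y Uy|j].
  exact: (proj1 (df j)).
by case: (df j) => _ [c _]; apply: c; rewrite inE.
Qed.

(** Only the restriction of [tau] to the line through [x] along [v] matters, so [tau] need not be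
    differentiable; [f] must be, which [Ck_on 1] ensures. *)
Lemma is_derive_curve n (U : set 'rV[R]_n) (V : normedModType R) f
    (tau : V -> 'rV[R]_n) x v (a : 'I_n -> R) : open U -> U (tau x) ->
  Ck_on 1 U f -> (forall j, is_derive x v (fun y => tau y ord0 j) (a j)) ->
  is_derive x v (f \o tau) (\sum_j a j * 'D_(e_ j) f (tau x)).
Proof.
move=> oU Utx Cf dtau; apply/derivable_lineP.
pose g (h : R) := tau (x + h *: v).
have g0 : g 0 = tau x by rewrite /g scale0r addr0.
have dgj j : is_derive (0:R) 1 (fun h => g h ord0 j) (a j).
  by have /derivable_lineP := dtau j.
have dg : derivable g (0 : R) 1.
  by apply/derivable_mxP => i j; rewrite ord1; have [] := dgj j.
have gd : differentiable g 0 by apply/derivable1_diffP.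
have df := Ck_on_is_diff oU Utx Cf; rewrite -g0 in df.
have fd : differentiable f (g 0) by exact: ex_diff.
have fgd : differentiable (f \o g) 0 by exact: differentiable_comp.
suff -> : \sum_j a j * 'D_(e_ j) f (tau x) = 'D_1 (f \o g) 0.
  by apply: DeriveDef => //; exact: diff_derivable.
have e1 : 'd g 0 1 = 'D_1 g 0 by rewrite deriveE.
rewrite deriveE// diff_comp//= e1 (derive_mx dg) diff_val g0.
by apply: eq_bigr => j _; rewrite mxE; case: (dgj j) => _ ->.
Qed.

Lemma Ck_on_sub n k (U V : set 'rV[R]_n) f : V `<=` U -> Ck_on k U f -> Ck_on k V f.
Proof.
move=> VU; elim: k f => [|k IH] f [cf df]; split.
- by move=> x xV; apply: cf; move: xV; rewrite !inE; exact: VU.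
- by [].
- by move=> x xV; apply: cf; move: xV; rewrite !inE; exact: VU.
- by move=> i; have [d C] := df i; split=> [x /VU|]; [exact: d|exact: IH].
Qed.

Lemma Ck_on_local n k (U : set 'rV[R]_n) f :
  (forall x, U x -> exists V, [/\ open V, V x & Ck_on k V f]) -> Ck_on k U f.
Proof.
elim: k f => [|k IH] f loc; (split; first by move=> x; rewrite inE => /loc [V [oV Vx [c _]]];
  apply: c; rewrite inE) => // i; split=> [x /loc [V [_ Vx [_ d]]]|].
  exact: (proj1 (d i)).
by apply: IH => x /loc [V [oV Vx [_ d]]]; exists V; split=> //; have [] := d i.
Qed.

Lemma Ck_on_coord n k (U : set 'rV[R]_n) j : Ck_on k U (fun x : 'rV[R]_n => x ord0 j).
Proof.
have c : {in U, continuous (fun x : 'rV[R]_n => x ord0 j : R)}.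
  by move=> x _; exact: coord_continuous.
case: k => [|k]; split=> // i.
have d (x : 'rV[R]_n) : is_derive x (e_ i) (fun x : 'rV[R]_n => x ord0 j : R) (i == j)%:R.
  have /derivable_mxP D : derivable id x (e_ i : 'rV[R]_n) by exact: derivable_id.
  apply: DeriveDef => //.
  have := derive_mx (@derivable_id R 'rV[R]_n x (e_ i)); rewrite derive_id.
  by move=> /matrixP/(_ ord0 j); rewrite !mxE eqxx /= => <-; rewrite eq_sym.
split=> [x _|]; first by have [] := d x.
have -> : 'D_(e_ i) (fun x : 'rV[R]_n => x ord0 j : R) = cst (i == j)%:R.
  by apply/funext => x; have [] := d x.
exact: Ck_on_cst.
Qed.

Lemma Ck_onZ n k (U : set 'rV[R]_n) (c : R) f : open U -> Ck_on k U f -> Ck_on k U (c *: f).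
Proof. by move=> oU; exact: (Ck_onM oU (Ck_on_cst k U c)). Qed.

Lemma Ck_onB n k (U : set 'rV[R]_n) f g : open U -> Ck_on k U f -> Ck_on k U g ->
  Ck_on k U (f - g).
Proof.
by move=> oU Cf Cg; rewrite -scaleN1r; apply: Ck_onD => //; exact: Ck_onZ.
Qed.

Lemma Ck_on_sum n k (U : set 'rV[R]_n) (I : Type) (r : seq I) (F : I -> 'rV[R]_n -> R) :
  open U -> (forall i, Ck_on k U (F i)) -> Ck_on k U (fun x => \sum_(i <- r) F i x).
Proof.
move=> oU CF; have -> : (fun x => \sum_(i <- r) F i x) = \sum_(i <- r) F i.
  by apply/funext => x; rewrite fct_sumE.
by elim/big_ind: _ => //; [exact: Ck_on_cst|move=> f g; exact: Ck_onD].
Qed.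

Lemma Ck_on_prod n k (U : set 'rV[R]_n) (I : Type) (r : seq I) (F : I -> 'rV[R]_n -> R) :
  open U -> (forall i, Ck_on k U (F i)) -> Ck_on k U (fun x => \prod_(i <- r) F i x).
Proof.
move=> oU CF; elim: r => [|i r IH].
  rewrite [X in Ck_on k U X](_ : _ = cst 1); first exact: Ck_on_cst.
  by apply/funext => x; rewrite big_nil.
rewrite [X in Ck_on k U X](_ : _ = F i * (fun x => \prod_(i <- r) F i x)); first exact: Ck_onM.
by apply/funext => x; rewrite big_cons.
Qed.

Lemma smooth_on_derive n (U : set 'rV[R]_n) f i : smooth_on U f -> smooth_on U ('D_(e_ i) f).
Proof. by move=> sf k; have [_ d] := sf k.+1; have [] := d i. Qed.

(** Induction on [k] with [f] varying: by the chain rule the partials of [f \o tau] are sums of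
    products of partials of [tau] and composites of partials of [f] with the same [tau]. *)
Lemma Ck_on_comp m n k (U : set 'rV[R]_m) (V : set 'rV[R]_n) f (tau : 'rV[R]_m -> 'rV[R]_n) :
  open U -> open V -> (forall x, U x -> V (tau x)) -> smooth_on V f ->
  (forall j, smooth_on U (fun x => tau x ord0 j)) -> Ck_on k U (f \o tau).
Proof.
move=> oU oV UV + st; elim: k f => [|k IH] f sf.
  split=> // x /set_mem Ux; apply: continuous_comp.
    by apply: rV_continuous_at => j; apply: (Ck_on_continuous (st j 0)); rewrite inE.
  by apply: (Ck_on_continuous (sf 0)); rewrite inE; exact: UV.
split; first exact: Ck_on_continuous (IH f sf).
move=> i.
have d x : U x -> is_derive x (e_ i) (f \o tau)
    (\sum_j 'D_(e_ i) (fun y => tau y ord0 j) x * 'D_(e_ j) f (tau x)).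
  move=> Ux; apply: (is_derive_curve oV (UV _ Ux) (sf 1)) => j.
  by apply: derivableP; have [_ /(_ i)[]] := st j 1; move/(_ _ Ux).
split=> [x /d[]//|].
apply: (@eq_Ck_on _ _ _ _ (fun x => \sum_j 'D_(e_ i) (fun y =>
  tau y ord0 j) x * 'D_(e_ j) f (tau x))) => //.
  by move=> x /d[].
apply: Ck_on_sum => // j; apply: Ck_onM => //; first exact: smooth_on_derive.
exact: (IH _ (smooth_on_derive j sf)).
Qed.

(** Smoothness of [psi] on [D] is encoded by a class [P] of functions stable under derivation there,
    which suits functions whose derivatives have a common shape, such as [flat]. *)
Lemma Ck_on_comp1 n k (U : set 'rV[R]_n) (D : set R) (P : (R -> R) -> Prop) psi u :
  open U -> (forall x, U x -> D (u x)) ->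
  (forall p, P p -> exists2 q, P q & forall t, D t -> is_derive t 1 p (q t)) ->
  P psi -> Ck_on k U u -> Ck_on k U (psi \o u).
Proof.
move=> oU UD clos; elim: k psi => [|k IH] psi Pp Cu; have [q Pq dq] := clos _ Pp.
all: have c : {in U, continuous (psi \o u)} by
  move=> x /[dup] xU /set_mem Ux; apply: continuous_comp;
    [exact: (Ck_on_continuous Cu)|
     apply/differentiable_continuous/derivable1_diffP; have [] := dq _ (UD _ Ux)].
  by [].
split=> // i; have Ck := Ck_onS Cu; case: Cu => _ /(_ i) [du Cdu].
have d x : U x -> is_derive x (e_ i) (psi \o u) (q (u x) * 'D_(e_ i) u x).
  by move=> Ux; apply: is_derive_comp1; [exact/dq/UD|exact/derivableP/du].
split=> [x /d[]//|].
apply: (@eq_Ck_on _ _ _ _ ((q \o u) * 'D_(e_ i) u)) => //; first by move=> x /d[].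
by apply: Ck_onM => //; exact: IH.
Qed.

Lemma Ck_onV n k (U : set 'rV[R]_n) u : open U -> (forall x, U x -> u x != 0) ->
  Ck_on k U u -> Ck_on k U (fun x => (u x)^-1).
Proof.
move=> oU u0; elim: k => [|k IH] Cu.
  split=> // x xU; apply: continuousV; last exact: (Ck_on_continuous Cu).
  by apply: u0; exact: set_mem.
have CV := IH (Ck_onS Cu); case: Cu => cu du; split=> [x xU|i].
  by apply: continuousV; [apply: u0; exact: set_mem|exact: cu].
have [dui Cui] := du i; split=> [x Ux|]; first by apply: derivableV; [exact: u0|exact: dui].
apply: (@eq_Ck_on _ _ _ _ (-1 *: ((fun x => (u x)^-1) * (fun x => (u x)^-1) * 'D_(e_ i) u))) =>
  //.
  move=> x Ux; rewrite deriveV; [|exact: u0|exact: dui].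
  by rewrite !fctE /GRing.scale /= mulN1r mulNr expr2 invfM.
by apply: Ck_onZ => //; apply: Ck_onM => //; exact: Ck_onM.
Qed.

End CkOn.

(** * Bump functions *)

Section Bump.
Context {R : realType}.
Implicit Types (p : {poly R}) (t : R).

Lemma is_derive0_quadratic (f : R -> R) (C : R) :
  (forall t, `|t| <= 1 -> `|f t - f 0| <= C * t ^+ 2) -> is_derive (0 : R) 1 f 0.
Proof.
move=> fC; have C0 : 0 <= C.
  by have := fC 1; rewrite normr1 expr1n mulr1 => /(_ (lexx _)); exact: le_trans.
suff L : (fun h : R => h^-1 *: (f (h *: 1 + 0) - f 0)) h @[h --> 0^'] --> (0 : R).
  split; first by apply/cvg_ex; exists 0.
  exact: cvg_lim L.
apply/cvgrPdist_le => e e0.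
have e1 : 0 < e / (C + 1) by rewrite divr_gt0// ltr_wpDl.
near=> h; have h1 : `|h| <= 1 by near: h; apply: dnbhs0_le.
have he : `|h| <= e / (C + 1) by near: h; apply: dnbhs0_le.
have h0 : h != 0 by near: h; exact: nbhs_dnbhs_neq.
rewrite sub0r normrN addr0 [h *: 1]mulr1 [X in `|X|]/(_ * _) normrM normfV.
rewrite mulrC ler_pdivrMr ?normr_gt0//; apply: le_trans (fC h h1) _.
rewrite -(real_normK (num_real h)) expr2 mulrA ler_wpM2r//.
apply: le_trans (_ : C * (e / (C + 1)) <= e); first by rewrite ler_wpM2l.
by rewrite mulrCA ler_piMr ?(ltW e0)// ler_pdivrMr ?ltr_wpDl// mul1r lerDl.
Unshelve. all: by end_near. Qed.

Lemma horner_growth p : exists2 C, 0 <= C & forall x : R, 1 <= x -> `|p.[x]| <= C * x ^+ size p.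
Proof.
exists (\sum_(i < size p) `|p`_i|); first exact: sumr_ge0.
move=> x x1; rewrite horner_coef mulr_suml; apply: le_trans (ler_norm_sum _ _ _) _.
apply: ler_sum => i _; rewrite normrM normrX ler_wpM2l//.
rewrite ger0_norm; last exact: le_trans x1.
by apply: ler_weXn2l => //; exact: ltnW.
Qed.

Definition flat p t : R := if 0 < t then p.[t^-1] * expR (- t^-1) else 0.

Lemma flat_quadratic p : exists C, forall t, `|t| <= 1 -> `|flat p t| <= C * t ^+ 2.
Proof.
have [C C0 pC] := horner_growth p.
pose s := size p; exists (C * (s.+2)`!%:R) => t; rewrite /flat.
case: ltP => [t0|_ _]; last by rewrite normr0 mulr_ge0 ?sqr_ge0 ?mulr_ge0.
rewrite gtr0_norm// => t1.
have x1 : 1 <= t^-1 by rewrite invf_ge1.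
have x0 : 0 < t^-1 by rewrite invr_gt0.
rewrite normrM (ger0_norm (expR_ge0 _)) expRN.
have fac0 : 0 < (s.+2)`!%:R :> R by rewrite ltr0n fact_gt0.
(* One term of the exponential series: the exponent exceeds the growth [s] of the polynomial by two,
   and these two powers remain as [t ^+ 2]. *)
have eb : t^-1 ^+ s.+2 / (s.+2)`!%:R <= expR t^-1.
  apply: le_trans (expR_ge1Dxn s.+1 (ltW x0)); by rewrite lerDr.
apply: (@le_trans _ _ (C * t^-1 ^+ s * (t^-1 ^+ s.+2 / (s.+2)`!%:R)^-1)).
  rewrite ler_pM ?invr_ge0 ?expR_ge0 ?pC//.
  by rewrite lef_pV2// ?posrE ?expR_gt0// divr_gt0// exprn_gt0.
have E : t^-1 ^+ s * t ^+ s = 1 by rewrite -exprMn mulVf ?expr1n ?gt_eqF.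
have -> : (t^-1 ^+ s.+2 / (s.+2)`!%:R)^-1 = (s.+2)`!%:R * (t ^+ s * t ^+ 2).
  by rewrite -exprD addn2 invfM invrK mulrC exprVn invrK.
rewrite (_ : _ * _ = C * (s.+2)`!%:R * t ^+ 2 * (t^-1 ^+ s * t ^+ s)); last by ring.
by rewrite E mulr1.
Qed.

Lemma is_derive_flat p t : is_derive t 1 (flat p) (flat ('X^2 * (p - p^`())) t).
Proof.
have [t0|t0|->] := ltrgt0P t.
- have dV : is_derive t (1 : R) (fun t => t^-1) (- t^-1 ^+ 2).
    have := @is_deriveV _ (fun t : R => t) t 1 1 (lt0r_neq0 t0) (is_derive_id _ _).
    by rewrite /GRing.scale /= mulr1 exprVn.
  have dN : is_derive t (1 : R) (fun t => - t^-1) (t^-1 ^+ 2).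
    by have := is_deriveN dV; rewrite opprK.
  have dp : is_derive (t^-1) (1 : R) (horner p) p^`().[t^-1].
    by rewrite derivE derive1E; apply/derivableP/derivable_horner.
  apply: (@near_eq_is_derive _ _ _ (fun t => p.[t^-1] * expR (- t^-1))).
    near=> s; rewrite /flat ifT//; near: s; exact: lt_nbhsr.
  have := is_deriveM (@is_derive_comp1 R R (horner p) (fun t => t^-1) t 1 _ _ dp dV)
    (@is_derive_comp1 R R expR (fun t => - t^-1) t 1 _ _ (is_derive_expR _) dN).
  move=> D; apply: (is_derive_eq D); rewrite /flat t0.
  transitivity (p.[t^-1] * (expR (- t^-1) * t^-1 ^+ 2) +
    expR (- t^-1) * (p^`().[t^-1] * - t^-1 ^+ 2)); first by [].
  by rewrite hornerM hornerXn hornerD hornerN; ring.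
- apply: (@near_eq_is_derive _ _ _ (cst 0)).
    near=> s; rewrite /flat ltNge ltW//; near: s; exact: lt_nbhsl.
  by rewrite /flat ltNge (ltW t0) /=; exact: is_derive_cst.
- rewrite {2}/flat ltxx; have [C fC] := flat_quadratic p.
  apply: (@is_derive0_quadratic _ C) => s /fC.
  by rewrite {3}/flat ltxx subr0.
Unshelve. all: by end_near. Qed.

(** The argument will be a squared ratio of lengths, squares being smooth where absolute values are
    not; the threshold 1/4 is thus half the radius. *)
Definition step (t : R) : R := flat 1 (1 - t) / (flat 1 (1 - t) + flat 1 (t - 4^-1)).

Lemma flat1_gt0 t : (0 < flat 1 t) = (0 < t).
Proof. by rewrite /flat; case: ifP => t0; rewrite ?ltxx// hornerC mul1r expR_gt0. Qed.

Lemma flat1_ge0 t : 0 <= flat 1 t.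
Proof. by rewrite /flat; case: ifP => // t0; rewrite hornerC mul1r expR_ge0. Qed.

Lemma flat1_le0 t : t <= 0 -> flat 1 t = 0.
Proof. by rewrite /flat; case: ltP. Qed.

Lemma step_den t : flat 1 (1 - t) + flat 1 (t - 4^-1) != 0.
Proof.
rewrite gt_eqF//; have [t1|t1] := ltP t 1.
  by rewrite ltr_wpDr ?flat1_ge0// flat1_gt0 subr_gt0.
by rewrite ltr_wpDl ?flat1_ge0// flat1_gt0; lra.
Qed.

Lemma step1 t : t <= 4^-1 -> step t = 1.
Proof.
move=> t4; have := step_den t; rewrite /step (@flat1_le0 (t - _)) ?subr_le0//.
by rewrite addr0; exact: divff.
Qed.

Lemma step0 t : 1 <= t -> step t = 0.
Proof. by move=> t1; rewrite /step flat1_le0 ?subr_le0// mul0r. Qed.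

Lemma Ck_on_step n k (U : set 'rV[R]_n) u : open U -> Ck_on k U u -> Ck_on k U (step \o u).
Proof.
move=> oU Cu.
have Cf w : Ck_on k U w -> Ck_on k U (flat 1 \o w).
  apply: (@Ck_on_comp1 _ _ _ _ setT (fun q => exists p, q = flat p)) => //; last by exists 1.
  move=> _ [p ->]; exists (flat ('X^2 * (p - p^`()))); first by eexists.
  by move=> t _; exact: is_derive_flat.
have C1 : Ck_on k U (flat 1 \o (cst 1 - u)) by apply/Cf/Ck_onB => //; exact: Ck_on_cst.
have C2 : Ck_on k U (flat 1 \o (u - cst 4^-1)) by apply/Cf/Ck_onB => //; exact: Ck_on_cst.
apply: (Ck_onM oU C1); apply: Ck_onV => //; last exact: Ck_onD.
by move=> x _; exact: step_den.
Qed.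

(** A product over the coordinates matches the maximum norm: on the half ball all factors are 1, and
    outside the ball some coordinate makes its factor 0. *)
Lemma exists_bump n (x0 : 'rV[R]_n) (r : R) : 0 < r ->
  exists chi : 'rV[R]_n -> R, [/\ smooth_on setT chi,
    forall x, `|x - x0| <= r / 2 -> chi x = 1 &
    forall x, r <= `|x - x0| -> chi x = 0].
Proof.
move=> r0; pose u j (x : 'rV[R]_n) := r^-1 ^+ 2 * (x ord0 j - x0 ord0 j) ^+ 2.
have uE j x : u j x = (`|x ord0 j - x0 ord0 j| / r) ^+ 2.
  by rewrite /u mulrC exprMn real_normK ?num_real.
exists (fun x => \prod_j step (u j x)); split.
- move=> k; apply: Ck_on_prod => [|j]; first exact: openT.
  apply: Ck_on_step; first exact: openT.
  have C : Ck_on k setT (fun x : 'rV[R]_n => x ord0 j - x0 ord0 j).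
    apply: (Ck_onB openT (Ck_on_coord k setT j) (Ck_on_cst k setT _)).
  exact: (Ck_onZ _ openT (Ck_onM openT C C)).
- move=> x xr; apply: big1 => j _; apply: step1; rewrite uE.
  have xj : `|x ord0 j - x0 ord0 j| / r <= 2^-1.
    rewrite ler_pdivrMr// mulrC; apply: le_trans xr.
    by have := ler_coord_norm (x - x0) j; rewrite !mxE.
  rewrite (_ : 4^-1 = 2^-1 ^+ 2 :> R); last by field.
  by rewrite ler_sqr ?nnegrE ?divr_ge0 ?invr_ge0// ltW.
- move=> x xr; have [j xj] : exists j, r <= `|x ord0 j - x0 ord0 j|.
    apply: contrapT => /forallNP xj; move: xr; apply/negP; rewrite -ltNge.
    by apply: normr_rV_lt => // j; rewrite !mxE ltNge; apply/negP/xj.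
  rewrite (bigD1 j)//= step0 ?mul0r// uE -[X in X <= _](expr1n _ 2%N).
  by rewrite ler_sqr ?nnegrE ?divr_ge0 ?(ltW r0)// ler_pdivlMr// mul1r.
Qed.

End Bump.

(** * Hadamard's lemma *)

Section MeanValue.
Context {R : realType}.
Implicit Types (phi psi F : R -> R).

Definition cont01 phi := forall t : R, 0 <= t <= 1 -> {for t, continuous phi}.

Definition int01 phi : R := \int[@lebesgue_measure R]_(t in `[0, 1]) phi t.

Lemma cont01_within phi : cont01 phi -> {within `[0, 1], continuous phi}.
Proof.
by move=> c; apply: continuous_in_subspaceT => t; rewrite inE /= in_itv /=; exact: c.
Qed.

Lemma cont01_integrable phi : cont01 phi ->
  (@lebesgue_measure R).-integrable `[0, 1] (EFin \o phi).
Proof.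
move=> /cont01_within; apply: continuous_compact_integrable; exact: segment_compact.
Qed.

Lemma cont01B phi psi : cont01 phi -> cont01 psi -> cont01 (fun t => phi t - psi t).
Proof. by move=> c d t t01; apply: continuousB; [exact: c|exact: d]. Qed.

Lemma cont01Z (a : R) phi : cont01 phi -> cont01 (fun t => a * phi t).
Proof. by move=> c t t01; apply: continuousM; [exact: cst_continuous|exact: c]. Qed.

Lemma int01B phi psi : cont01 phi -> cont01 psi ->
  int01 (fun t => phi t - psi t) = int01 phi - int01 psi.
Proof. by move=> c d; rewrite /int01 RintegralB//; exact: cont01_integrable. Qed.

Lemma int01Z (a : R) phi : cont01 phi -> int01 (fun t => a * phi t) = a * int01 phi.
Proof. by move=> c; rewrite /int01 RintegralZl//; exact: cont01_integrable. Qed.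

Lemma int01_FTC F phi : (forall t : R, 0 <= t <= 1 -> is_derive t (1 : R) F (phi t)) ->
  cont01 phi -> int01 phi = F 1 - F 0.
Proof.
move=> dF c; have cF : cont01 F.
  by move=> t /dF d; apply/differentiable_continuous/derivable1_diffP; exact: ex_derive.
rewrite /int01 /Rintegral (@continuous_FTC2 _ _ F)//.
- exact: cont01_within.
- split.
  + by move=> t; rewrite in_itv /= => /andP[t0 t1]; have [] := dF t ltac:(rewrite !ltW//).
  + by apply: cvg_at_right_filter; apply: cF; rewrite lexx ler01.
  + by apply: cvg_at_left_filter; apply: cF; rewrite lexx ler01.
- move=> t; rewrite in_itv /= => /andP[t0 t1]; rewrite derive1E.
  by have [] := dF t ltac:(rewrite !ltW//).
Qed.

Lemma int01_cst (a : R) : int01 (cst a) = a.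
Proof.
have dF (t : R) : 0 <= t <= 1 -> is_derive t (1 : R) (a *: (id : R -> R)) (cst a t).
  move=> _; have := @is_deriveZ R R R id a t 1 1 (is_derive_id _ _).
  by rewrite (_ : a *: (1 : R) = a)//; exact: mulr1.
rewrite (int01_FTC dF); last by move=> t _; exact: cst_continuous.
by rewrite !fctE /= /GRing.scale /= mulr1 mulr0 subr0.
Qed.

Lemma cont01_sum (I : Type) (r : seq I) (c : I -> R) (phi : I -> R -> R) :
  (forall i, cont01 (phi i)) -> cont01 (fun t => \sum_(i <- r) c i * phi i t).
Proof.
move=> cphi; elim: r => [|i r IH].
  rewrite [X in cont01 X](_ : _ = cst 0); first by move=> t _; exact: cst_continuous.
  by apply/funext => t; rewrite big_nil.
rewrite [X in cont01 X](_ : _ = (fun t => c i * phi i t) \+ (fun t =>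
  \sum_(j <- r) c j * phi j t)).
  by move=> t t01; apply: continuousD; [exact: (cont01Z (cphi i) t01)|exact: IH].
by apply/funext => t; rewrite big_cons.
Qed.

Lemma int01_sum (I : Type) (r : seq I) (c : I -> R) (phi : I -> R -> R) :
  (forall i, cont01 (phi i)) ->
  int01 (fun t => \sum_(i <- r) c i * phi i t) = \sum_(i <- r) c i * int01 (phi i).
Proof.
move=> cphi; elim: r => [|i r IH].
  by rewrite big_nil -[RHS]int01_cst; congr int01; apply/funext => t; rewrite big_nil.
rewrite big_cons -IH -int01Z// /int01 -RintegralD//.
- by congr Rintegral; apply/funext => t; rewrite big_cons.
- exact/cont01_integrable/cont01Z.
- exact/cont01_integrable/cont01_sum.
Qed.

Lemma int01_le phi (e : R) : cont01 phi -> (forall t : R, 0 <= t <= 1 -> `|phi t| <= e) ->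
  `|int01 phi| <= e.
Proof.
move=> c phie; have cn : cont01 (fun t => `|phi t|).
  by move=> t /c ct; apply: continuous_comp ct _; exact: norm_continuous.
apply: le_trans (le_normr_Rintegral _ (cont01_integrable c)) _ => //.
rewrite -[leRHS]int01_cst; apply: le_Rintegral => //.
- exact: cont01_integrable.
- by apply: cont01_integrable => t _; exact: cst_continuous.
Qed.

End MeanValue.

Section Hadamard.
Context {R : realType} {n : nat}.
Local Notation E := 'rV[R]_n.
Local Notation e_ i := (delta_mx ord0 i : E).
Variables (U : set E) (y : E).
Hypotheses (oU : open U)
  (starU : forall x (t : R), U x -> 0 <= t <= 1 -> U (y + t *: (x - y))).
Implicit Types (f : E -> R) (x : E).

Let ray x (t : R) := y + t *: (x - y).

Let ray_cvg x (t : R) : ray p.1 p.2 @[p --> (x, t)] --> ray x t.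
Proof.
apply: cvgD; first exact: cvg_cst.
apply: cvgZ; first exact: cvg_snd.
by apply: cvgB; [exact: cvg_fst|exact: cvg_cst].
Qed.

Let ray_cont x (t : R) : ray x s @[s --> t] --> ray x t.
Proof.
apply: cvgD; first exact: cvg_cst.
by apply: cvgZ; [exact: cvg_id|exact: cvg_cst].
Qed.

Let ray_cont01 f x m : {in U, continuous f} -> U x -> cont01 (fun t => t ^+ m * f (ray x t)).
Proof.
move=> cf Ux t t01; apply: continuousM; first exact: exprn_continuous.
by apply: (cvg_comp _ _ (@ray_cont x t)); apply: cf; rewrite inE; exact: starU.
Qed.

(** Compactness of [0, 1] makes the continuity uniform in [t], which allows limits and derivatives
    to pass under the integral. *)
Let uniform_ray f x (e : R) : {in U, continuous f} -> U x -> 0 < e ->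
  \forall x' \near x, forall t : R, 0 <= t <= 1 -> `|f (ray x' t) - f (ray x t)| <= e.
Proof.
move=> cf Ux e0.
have /compact_near_coveringP/(_ E (nbhs x) (fun x' t => `|f (ray x' t) - f (ray x t)| <= e)) :=
  @segment_compact R 0 1.
have /[swap]/[apply] : forall t : R, `[0, 1]%classic t -> \forall t' \near t & x' \near x,
    `|f (ray x' t') - f (ray x t')| <= e.
  move=> t; rewrite /= in_itv /= => t01.
  have e2 : 0 < e / 2 by rewrite divr_gt0.
  have cft : {for ray x t, continuous f} by apply: cf; rewrite inE; exact: starU.
  have /cvgrPdist_le/(_ _ e2) c1 := cvg_comp _ _ (@ray_cvg x t) cft.
  have /cvgrPdist_le/(_ _ e2) c2 := cvg_comp _ _ (@ray_cont x t) cft.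
  have [[A B] [nA nB] AB] := c1.
  exists (B `&` [set t' | `|f (ray x t) - f (ray x t')| <= e / 2], A).
    by split=> //; exact: filterI.
  move=> -[t' x'] [/= [Bt tt'] Ax].
  rewrite -(subrKA (f (ray x t))) (le_trans (ler_normD _ _))// (splitr e) lerD//.
  by rewrite distrC; exact: (AB (x', t')).
by apply: filterS => x' h t t01; apply: h; rewrite /= in_itv.
Qed.

(** The weight [t ^+ m] makes the family stable under derivation: moving [x] by [h] along a basis
    vector moves the point of the ray by [t * h], so each partial derivative raises [m] by one. *)
Let mean m f x := int01 (fun t => t ^+ m * f (ray x t)).

Let expr_le1 (t : R) m : 0 <= t <= 1 -> `|t ^+ m| <= 1.
Proof. by move=> /andP[t0 t1]; rewrite normrX ger0_norm// exprn_ile1. Qed.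

Let mean_continuous m f : {in U, continuous f} -> {in U, continuous (mean m f)}.
Proof.
move=> cf x /set_mem Ux; apply/(@cvgrPdist_le _ R _ (nbhs x)) => e e0.
have Unear : \forall x' \near x, U x' by exact: open_nbhs_nbhs.
have Ue := uniform_ray cf Ux e0.
near=> x'; have Ux' : U x' by near: x'.
have fe : forall t : R, 0 <= t <= 1 -> `|f (ray x' t) - f (ray x t)| <= e by near: x'.
rewrite distrC -int01B; [|exact: ray_cont01|exact: ray_cont01].
apply: int01_le => [|t t01]; first by apply: cont01B; exact: ray_cont01.
by rewrite -mulrBr normrM (le_trans _ (fe _ t01))// ler_piMl// expr_le1.
Unshelve. all: by end_near. Qed.

Let mean_derive m f i x : Ck_on 1 U f -> U x ->
  is_derive x (e_ i) (mean m f) (mean m.+1 ('D_(e_ i) f) x).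
Proof.
move=> [cf dfU] Ux; have [df [cdf _]] := dfU i.
suff L : (fun h : R => h^-1 *: (mean m f (h *: e_ i + x) - mean m f x)) h @[h --> 0^']
    --> mean m.+1 ('D_(e_ i) f) x.
  split; first by apply/cvg_ex; eexists; exact: L.
  exact: cvg_lim L.
apply/cvgrPdist_le => e e0.
have /nbhs_normP[d /= d0 dP] : \forall x' \near x, U x' /\
    forall t : R, 0 <= t <= 1 -> `|'D_(e_ i) f (ray x' t) - 'D_(e_ i) f (ray x t)| <= e.
  have Unear : \forall x' \near x, U x' by exact: open_nbhs_nbhs.
  have Ue := uniform_ray cdf Ux e0.
  by near=> x'; split; near: x'.
near=> h.
have h0 : h != 0 by near: h; exact: nbhs_dnbhs_neq.
have hd : `|h| < d by near: h; exact: dnbhs0_lt.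
have near_x (s : R) : 0 <= s <= 1 -> U (x + (s * h) *: e_ i) /\ forall t : R, 0 <= t <= 1 ->
    `|'D_(e_ i) f (ray (x + (s * h) *: e_ i) t) - 'D_(e_ i) f (ray x t)| <= e.
  move=> /andP[s0 s1]; apply: dP; rewrite /= opprD addNKr normrN.
  apply: le_lt_trans hd; apply: normr_rV_le => // j; rewrite !mxE eqxx /=.
  case: eqVneq => _; last by rewrite mulr0 normr0.
  by rewrite mulr1 normrM (ger0_norm s0) ler_piMl.
have Uxh : U (x + h *: e_ i) by have := near_x 1; rewrite mul1r lexx ler01 => -[].
have -> : h^-1 *: (mean m f (h *: e_ i + x) - mean m f x) =
    int01 (fun t => h^-1 * (t ^+ m * f (ray (x + h *: e_ i) t) - t ^+ m * f (ray x t))).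
  rewrite int01Z; last by apply: cont01B; exact: ray_cont01.
  by rewrite int01B ?(addrC _ x)//; exact: ray_cont01.
rewrite distrC /mean.
rewrite -int01B; last 2 first.
- by apply/cont01Z/cont01B; exact: ray_cont01.
- exact: (@ray_cont01 _ x m.+1 cdf Ux).
apply: int01_le => [|t t01].
  apply: cont01B; last exact: (@ray_cont01 _ x m.+1 cdf Ux).
  by apply/cont01Z/cont01B; exact: ray_cont01.
have rayE (s : R) : ray x t + (s * (t * h)) *: e_ i = ray (x + (s * h) *: e_ i) t.
  by rewrite /ray (addrAC x) [t *: (x - y + _)]scalerDr scalerA addrA (mulrCA t).
(* The difference quotient under the integral is a value of the partial derivative at a nearby ray,
   uniformly close to the expected one. *)
have [|s s01 E] := @MVT_line R E f (ray x t) (e_ i) (t * h).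
  by move=> s s01; rewrite rayE; apply: df; apply: starU t01; have [] := near_x _ s01.
have := rayE 1; rewrite !mul1r => rE; rewrite rE rayE in E.
rewrite -mulrBr E.
have -> : h^-1 * (t ^+ m * (t * h * 'D_(e_ i) f (ray (x + (s * h) *: e_ i) t))) -
    t ^+ m.+1 * 'D_(e_ i) f (ray x t) = t ^+ m.+1 *
    ('D_(e_ i) f (ray (x + (s * h) *: e_ i) t) - 'D_(e_ i) f (ray x t)).
  by rewrite exprSr; field.
rewrite normrM; have [_ /(_ _ t01) le] := near_x _ s01.
by rewrite (le_trans _ le)// ler_piMl// expr_le1.
Unshelve. all: by end_near. Qed.

Let mean_Ck k m f : smooth_on U f -> Ck_on k U (mean m f).
Proof.
elim: k m f => [|k IH] m f sf.
  by split=> //; apply: mean_continuous; exact: (Ck_on_continuous (sf 0)).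
split; first by apply: mean_continuous; exact: (Ck_on_continuous (sf 0)).
move=> i; have d x : U x -> is_derive x (e_ i) (mean m f) (mean m.+1 ('D_(e_ i) f) x).
  exact: (mean_derive _ _ (sf 1)).
split=> [x /d[]//|]; apply: (eq_Ck_on oU _ (IH m.+1 _ (smooth_on_derive i sf))).
by move=> x /d[].
Qed.

(** [h j] is the mean of the [j]-th partial derivative along the ray from [y] to [x]; the expansion
    is the fundamental theorem of calculus on that ray. *)
Lemma hadamard f : U y -> smooth_on U f -> exists h : 'I_n -> E -> R,
  [/\ forall j, smooth_on U (h j),
      forall j, h j y = 'D_(e_ j) f y &
      forall x, U x -> f x = f y + \sum_j (x ord0 j - y ord0 j) * h j x].
Proof.
move=> Uy sf; exists (fun j => mean 0 ('D_(e_ j) f)); split.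
- by move=> j k; apply: mean_Ck; exact: smooth_on_derive.
- move=> j; rewrite /mean -[RHS]int01_cst; congr int01; apply/funext => t /=.
  by rewrite /ray subrr scaler0 addr0 mul1r.
move=> x Ux.
have cD j : cont01 (fun t => 'D_(e_ j) f (ray x t)).
  move=> t t01; have c : {for ray x t, continuous ('D_(e_ j) f)}.
    by apply: (Ck_on_continuous (smooth_on_derive j sf 0)); rewrite inE; exact: starU.
  exact: (cvg_comp _ _ (@ray_cont x t) c).
pose phi (t : R) := \sum_j (x ord0 j - y ord0 j) * 'D_(e_ j) f (ray x t).
have dphi (t : R) : 0 <= t <= 1 -> is_derive t (1 : R) (f \o ray x) (phi t).
  move=> t01; apply: (@is_derive_curve R n U R f (ray x) t 1 (fun j => x ord0 j - y ord0 j)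
    oU (starU Ux t01) (sf 1)) => j.
  have := @is_derive_line R R id (y ord0 j) (x ord0 j - y ord0 j) t.
  rewrite derive_id => /(_ (@derivable_id _ _ _ _)).
  by congr (is_derive _ _ _ _); apply/funext => s; rewrite /ray !mxE.
have := int01_FTC dphi (cont01_sum cD).
rewrite /phi int01_sum//= /ray scale1r subrKC scale0r addr0.
move=> /eqP; rewrite eq_sym subr_eq addrC => /eqP ->; congr (_ + _); apply: eq_bigr => j _.
by congr (_ * int01 _); apply/funext => t; rewrite mul1r.
Qed.

End Hadamard.

(** * Smooth functions and frames supported in a chart *)

Section SmoothFunctionEval.
Context {R : realType} {n : nat} {M : manifold R n}.
Implicit Types (f g : sfun M) (p : M).

Lemma sfunDE f g p : (f + g) p = f p + g p. Proof. by []. Qed.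
Lemma sfunNE f p : (- f) p = - f p. Proof. by []. Qed.
Lemma sfunBE f g p : (f - g) p = f p - g p. Proof. by []. Qed.
Lemma sfunME f g p : (f * g) p = f p * g p. Proof. by []. Qed.
Lemma sfunZE (a : R) f p : (a *: f) p = a * f p. Proof. by []. Qed.
Lemma sfun0E p : (0 : sfun M) p = 0. Proof. by []. Qed.
Lemma sfun1E p : (1 : sfun M) p = 1. Proof. by []. Qed.
Lemma sfun_sumE (I : Type) (r : seq I) (P : pred I) (F : I -> sfun M) p :
  (\sum_(i <- r | P i) F i) p = \sum_(i <- r | P i) F i p.
Proof. exact: (big_morph (fun f : sfun M => f p)). Qed.

Definition sfunE := (sfunDE, sfunNE, sfunME, sfunZE, sfun0E, sfun1E).

Lemma vfieldDE (X Y : vfield M) f : (X + Y) f = X f + Y f. Proof. by []. Qed.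
Lemma vfieldNE (X : vfield M) f : (- X) f = - X f. Proof. by []. Qed.
Lemma vfieldZE g (X : vfield M) f : (g *: X) f = g * X f. Proof. by []. Qed.
Lemma vfield_sumE (I : Type) (r : seq I) (P : pred I) (F : I -> vfield M) f :
  (\sum_(i <- r | P i) F i) f = \sum_(i <- r | P i) F i f.
Proof. exact: (big_morph (fun X : vfield M => X f)). Qed.

Lemma vf0 (X : vfield M) : X 0 = 0.
Proof. by apply: (@addIr _ (X 0)); rewrite add0r -vfD addr0. Qed.

Lemma vfZ (X : vfield M) (a : R) f : X (a *: f) = a *: X f.
Proof. by rewrite -[a *: f]addr0 vf_linear vf0 addr0. Qed.

Lemma vfN (X : vfield M) f : X (- f) = - X f.
Proof. by rewrite -scaleN1r vfZ scaleN1r. Qed.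

Lemma vfB (X : vfield M) f g : X (f - g) = X f - X g.
Proof. by rewrite vfD vfN. Qed.

Lemma vf1 (X : vfield M) : X 1 = 0.
Proof.
by apply: (@addIr _ (X 1)); rewrite add0r -{3}(mulr1 1) vf_leibniz mulr1 mul1r.
Qed.

Lemma vf_sum (X : vfield M) (I : Type) (r : seq I) (F : I -> sfun M) :
  X (\sum_(i <- r) F i) = \sum_(i <- r) X (F i).
Proof. exact: (big_morph X (vfD X) (vf0 X)). Qed.

End SmoothFunctionEval.

Lemma chart_cinv (R : realType) n (T : topologicalType) (d : chart R n T) x :
  (cmap d @` cdom d) x -> cdom d (cinv d x) /\ cmap d (cinv d x) = x.
Proof. by move=> [p pc <-]; rewrite cmapK ?inE. Qed.

Section ChartBall.
Context {R : realType} {n : nat} {M : manifold R n}.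
Local Notation E := 'rV[R]_n.
Local Notation e_ i := (delta_mx ord0 i : E).
Variables (c : chart R n M) (x0 : E) (r : R) (chi : E -> R).
Hypotheses (Ac : atlas M c) (r0 : 0 < r).
Let W : set E := [set x | `|x - x0| < 2 * r].
Hypotheses (W_img : W `<=` cmap c @` cdom c) (chi_smooth : smooth_on setT chi)
  (chi1 : forall x, `|x - x0| <= r / 2 -> chi x = 1)
  (chi0 : forall x, r <= `|x - x0| -> chi x = 0).

Let oW : open W.
Proof.
rewrite (_ : W = ball x0 (2 * r)); first exact: ball_open.
by rewrite -ball_normE /W; apply/seteqP; split => x /=; rewrite distrC.
Qed.

Let K : set E := [set x | `|x - x0| <= r].

Let KW : K `<=` W.
Proof. by move=> x /= /le_lt_trans; apply; rewrite mulr2n mulrDl mul1r ltrDl. Qed.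

Let cK : compact K.
Proof.
rewrite (_ : K = closed_ball x0 r); last first.
  by rewrite closed_ballE// /K /closed_ball_; apply/seteqP; split => x /=; rewrite distrC.
apply: bounded_closed_compact; last exact: closed_ball_closed.
rewrite closed_ballE//; exists (`|x0| + r); split; first exact: num_real.
move=> b xb x; rewrite /closed_ball_ /= distrC => xr; apply: le_trans (ltW xb).
by rewrite -[x](subrK x0) addrC (le_trans (ler_normD _ _))// lerD2l.
Qed.

Let KM : set M := cinv c @` K.

Let closed_KM : closed KM.
Proof.
apply: compact_closed; first exact: manifold_hausdorff.
apply: continuous_compact cK; apply: continuous_in_subspaceT => x /set_mem Kx.
by apply: cinv_continuous; rewrite inE; exact/W_img/KW.
Qed.

(** The cutoff is built in, so the result agrees with [u] only where [chi] is 1, that is, on the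
    ball of radius [r / 2]. *)
Definition chart_extension (u : E -> R) (p : M) : R :=
  if `[< cdom c p >] then chi (cmap c p) * u (cmap c p) else 0.

Let ext0 u p : ~ KM p -> chart_extension u p = 0.
Proof.
rewrite /chart_extension; case: asboolP => // cp nK; rewrite chi0 ?mul0r//.
rewrite leNgt; apply/negP => /ltW Kp; apply: nK; exists (cmap c p) => //.
by rewrite cmapK// inE.
Qed.

Let A : set M := [set q | cdom c q /\ W (cmap c q)].

Let oA : open A.
Proof.
rewrite openE => q [cq Wq]; apply: filterI.
  by apply: open_nbhs_nbhs; split=> //; exact: cdom_open.
by apply: (cmap_continuous (mem_set cq)); exact: open_nbhs_nbhs.
Qed.

Let open_preim (d : chart R n M) (B : set M) : open B ->
  open [set z | (cmap d @` cdom d) z /\ B (cinv d z)].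
Proof.
move=> oB; rewrite openE => z [dz Bz]; apply: filterI.
  by apply: open_nbhs_nbhs; split=> //; exact: cimg_open.
by apply: (cinv_continuous (mem_set dz)); exact: open_nbhs_nbhs.
Qed.

(** Two open sets cover [M]: the chart ball [A], where the extension is [chi * u] read through a
    transition map, and the complement of [KM], where it is 0. The latter is open because [KM] is
    compact and [M] is Hausdorff. *)
Lemma smooth_chart_extension u : smooth_on W u -> smooth (chart_extension u).
Proof.
move=> su d Ad k; apply: Ck_on_local => z dz.
have [Ap|nAp] := pselect (A (cinv d z)); last first.
  have oC : open (~` KM) by rewrite openC; exact: closed_KM.
  have nK : (~` KM) (cinv d z).
    move=> [x Kx xz]; apply: nAp; rewrite -xz.
    by have [? e] := chart_cinv (W_img (KW Kx)); split; rewrite ?e//; exact: KW.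
  exists [set z | (cmap d @` cdom d) z /\ (~` KM) (cinv d z)]; split => //;
    first exact: open_preim.
  apply: (@eq_Ck_on _ _ _ _ (cst 0)); [exact: open_preim| |exact: Ck_on_cst].
  by move=> y [_ /ext0 e]; rewrite /= e.
exists [set z | (cmap d @` cdom d) z /\ A (cinv d z)]; split => //; first exact: open_preim.
have oV := @open_preim d _ oA.
apply: (@eq_Ck_on _ _ _ _ ((chi * u) \o (fun y => cmap c (cinv d y)))) => //.
  by move=> y [_ [cy _]]; rewrite /chart_extension /= asboolT.
apply: (@Ck_on_comp R n n k _ W (chi * u) (fun y => cmap c (cinv d y)) oV oW) => [y [_ []]//|j|j].
  by apply: Ck_onM => //; exact: (Ck_on_sub _ (chi_smooth j)).
move=> l; apply: (Ck_on_sub _ (atlas_compatible Ad Ac j l)) => y [dy [cy _]].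
by have [? e] := chart_cinv dy; exists (cinv d y).
Qed.

End ChartBall.

(** * Locality of derivations and local coordinate frames *)

Section ChartFrame.
Context {R : realType} {n : nat} {M : manifold R n}.
Local Notation E := 'rV[R]_n.
Local Notation e_ i := (delta_mx ord0 i : E).
Local Notation S := (sfun M).
Local Notation V := (vfield M).

(** Three concentric balls: radius [2 * r] lies in the chart, radius [r] contains the support of
    [chi], and [chi] is 1 on radius [r / 2]. *)
Record is_chart_ball (c : chart R n M) (x0 : E) (r : R) (chi : E -> R) : Prop := {
  ball_atlas : atlas M c;
  ball_radius : 0 < r;
  ball_image : [set x | `|x - x0| < 2 * r] `<=` cmap c @` cdom c;
  ball_smooth : smooth_on setT chi;
  ball_one : forall x, `|x - x0| <= r / 2 -> chi x = 1;
  ball_zero : forall x, r <= `|x - x0| -> chi x = 0 }.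

Lemma exists_chart_ball (p : M) (O : set M) : open O -> O p ->
  exists c r chi, [/\ is_chart_ball c (cmap c p) r chi, cdom c p &
    forall q, cdom c q -> `|cmap c q - cmap c p| < 2 * r -> O q].
Proof.
move=> oO Op; have [c Ac cp] := atlas_cover p.
pose B := [set z | (cmap c @` cdom c) z /\ O (cinv c z)].
have nB : nbhs (cmap c p) B.
  have dz : (cmap c @` cdom c) (cmap c p) by exists p.
  apply: filterI; first by apply: open_nbhs_nbhs; split=> //; exact: cimg_open.
  apply: (cinv_continuous (mem_set dz)); apply: open_nbhs_nbhs; split=> //.
  by rewrite cmapK// inE.
have /nbhs_normP[d /= d0 dB] := nB.
have d2 : 0 < d / 2 by rewrite divr_gt0.
have [chi [sc c1 c0]] := exists_bump (cmap c p) d2.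
have dd : 2 * (d / 2) = d by field.
have inB x : `|x - cmap c p| < d -> B x by move=> xd; apply: dB; rewrite /= distrC.
exists c, (d / 2), chi; split=> //.
  by split=> //; rewrite dd => x /= /inB[].
by rewrite dd => q cq /inB[_]; rewrite cmapK// inE.
Qed.

Definition point_ball (c : chart R n M) (x0 : E) (r : R) : set M :=
  [set q | cdom c q /\ `|cmap c q - x0| < r].

Lemma open_point_ball c x0 r : open (point_ball c x0 r).
Proof.
rewrite openE => q [cq qr]; apply: filterI.
  by apply: open_nbhs_nbhs; split=> //; exact: cdom_open.
suff nb : nbhs (cmap c q) [set x | `|x - x0| < r] by exact: (cmap_continuous (mem_set cq) nb).
apply: open_nbhs_nbhs; split=> //.
rewrite [X in open X](_ : _ = ball x0 r); first exact: ball_open.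
by rewrite -ball_normE; apply/seteqP; split => x /=; rewrite distrC.
Qed.

Lemma exists_sfun_bump (p : M) (O : set M) : open O -> O p ->
  exists chi : S, chi p = 1 /\ forall q, ~ O q -> chi q = 0.
Proof.
move=> oO Op; have [c [r [chi [B cp BO]]]] := exists_chart_ball oO Op.
have s1 : smooth_on [set x | `|x - cmap c p| < 2 * r] (cst 1 : E -> R) by move=> k;
  exact: Ck_on_cst.
have sm := smooth_chart_extension (ball_atlas B) (ball_radius B) (ball_image B)
  (ball_smooth B) (ball_zero B) s1.
exists (SFun (asboolT sm)); split=> [|q nO] /=.
  by rewrite /chart_extension asboolT// (ball_one B) ?mulr1// subrr normr0 ltW// divr_gt0//
    (ball_radius B).
rewrite /chart_extension; case: asboolP => // cq.
rewrite (ball_zero B) ?mul0r// leNgt; apply/negP => lt; apply: nO; apply: BO => //.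
by apply: lt_trans lt _; rewrite ltr_pMl ?(ball_radius B)// ltr1n.
Qed.

(** With a bump [chi] at [q] supported in [O], [f - g] equals [(1 - chi) * (f - g)], a product of
    two functions vanishing at [q], which a derivation kills there. *)
Lemma vf_local (Y : V) (f g : S) (O : set M) q : open O -> O q ->
  (forall p, O p -> f p = g p) -> Y f q = Y g q.
Proof.
move=> oO Oq fg; have [chi [c1 c0]] := exists_sfun_bump oO Oq.
apply/eqP; rewrite -subr_eq0 -sfunBE -vfB.
have -> : f - g = (1 - chi) * (f - g).
  apply: sfun_eqP => p; rewrite !sfunE; have [Op|/c0 ->] := pselect (O p).
    by rewrite fg// subrr mulr0.
  by rewrite subr0 mul1r.
by rewrite vf_leibniz !sfunE fg// c1 !subrr mulr0 mul0r addr0.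
Qed.

Lemma sfun_continuous (f : S) : continuous f.
Proof.
move=> p; have [c Ac cp] := atlas_cover p.
have fE : {near p, (f \o cinv c) \o cmap c =1 f}.
  have : \forall q \near p, cdom c q by apply: open_nbhs_nbhs; split=> //; exact: cdom_open.
  by apply: filterS => q cq /=; rewrite cmapK// inE.
rewrite /continuous_at -(nbhs_singleton fE); apply: cvg_trans (near_eq_cvg fE) _.
apply: continuous_comp; first by apply: cmap_continuous; rewrite inE.
by apply: (Ck_on_continuous (sfun_smooth f Ac 0)); rewrite inE; exists p.
Qed.

Section Frame.
Variables (c : chart R n M) (x0 : E) (r : R) (chi : E -> R).
Hypothesis (B : is_chart_ball c x0 r chi).
Local Notation W := [set x : E | `|x - x0| < 2 * r].

Let N := point_ball c x0 (r / 2).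

Let ext (u : E -> R) (su : smooth_on W u) : S :=
  SFun (asboolT (smooth_chart_extension (ball_atlas B) (ball_radius B) (ball_image B)
  (ball_smooth B) (ball_zero B) su)).

Let extE u (su : smooth_on W u) q : N q -> ext su q = u (cmap c q).
Proof.
move=> [cq qr]; rewrite /= /chart_extension asboolT// (ball_one B) ?mul1r//.
exact: ltW.
Qed.

Let hat (f : S) : smooth_on W (f \o cinv c).
Proof. by move=> k; apply: Ck_on_sub (sfun_smooth f (ball_atlas B) k); exact: ball_image B. Qed.

Let oW : open W.
Proof.
rewrite [X in open X](_ : _ = ball x0 (2 * r)); first exact: ball_open.
by rewrite -ball_normE; apply/seteqP; split => x /=; rewrite distrC.
Qed.

Let dhat (i : 'I_n) (f : S) : smooth_on W ('D_(e_ i) (f \o cinv c)) := smooth_on_derive i (hat f).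

Let W_of q : cdom c q -> chi (cmap c q) != 0 -> W (cmap c q).
Proof.
move=> cq; apply: contraNP => /negP; rewrite -leNgt => le; apply/eqP.
by apply: (ball_zero B); apply: le_trans le; rewrite ler_pMl ?(ball_radius B)// ler1n.
Qed.

Let der_linear i (a : R) (f h : S) : ext (dhat i (a *: f + h)) =
  a *: ext (dhat i f) + ext (dhat i h).
Proof.
apply: sfun_eqP => q; rewrite !sfunE /= /chart_extension; case: asboolP => cq;
  last by rewrite mulr0 addr0.
have [->|/(W_of cq) Wq] := eqVneq (chi (cmap c q)) 0; first by rewrite !mul0r mulr0 addr0.
have [_ /(_ i)[df _]] := hat f 1; have [_ /(_ i)[dh _]] := hat h 1.
have -> : (a *: f + h : S) \o cinv c = a \*: (f \o cinv c) + (h \o cinv c) by [].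
rewrite deriveD; [|by apply: derivableZ; exact: df|exact: dh].
by rewrite deriveZ; [|exact: df]; rewrite /GRing.scale /=; ring.
Qed.

Let der_leibniz i (f h : S) : ext (dhat i (f * h)) = ext (dhat i f) * h + f * ext (dhat i h).
Proof.
apply: sfun_eqP => q; rewrite !sfunE /= /chart_extension; case: asboolP => cq;
  last by rewrite mulr0 mul0r addr0.
have [->|/(W_of cq) Wq] := eqVneq (chi (cmap c q)) 0; first by rewrite !mul0r mulr0 addr0.
have [_ /(_ i)[df _]] := hat f 1; have [_ /(_ i)[dh _]] := hat h 1.
have -> : (f * h : S) \o cinv c = (f \o cinv c) * (h \o cinv c) by [].
rewrite deriveM; [|exact: df|exact: dh].
by rewrite /GRing.scale /= cmapK ?inE//; ring.
Qed.

Let frame i : V := VField (der_linear i) (der_leibniz i).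

Let coord_smooth j : smooth_on W (fun x : E => x ord0 j).
Proof. by move=> k; exact: Ck_on_coord. Qed.

Let coord j : S := ext (coord_smooth j).

(** Hadamard's expansion of [f] about [q] itself: applied to it, [Y] kills the constant, and at [q]
    only the terms differentiating a coordinate survive. The large ball is convex, hence star-shaped
    about [q]. *)
Let chart_span (Y : V) (f : S) q : N q -> Y f q = \sum_j Y (coord j) q * frame j f q.
Proof.
move=> Nq; have [cq qr] := Nq; pose y := cmap c q.
have r0 := ball_radius B.
have NW p : N p -> W (cmap c p).
  by move=> [_ pr]; apply: lt_trans pr _; lra.
have star x (t : R) : W x -> 0 <= t <= 1 -> W (y + t *: (x - y)).
  move=> /= Wx /andP[t0 t1]; have /= Wy := NW _ Nq.
  have -> : y + t *: (x - y) - x0 = (1 - t) *: (y - x0) + t *: (x - x0).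
    by apply/rowP => i; rewrite !mxE; ring.
  apply: le_lt_trans (ler_normD _ _) _; rewrite !normrZ (ger0_norm t0) ger0_norm ?subr_ge0//.
  rewrite -/y in Wy; have [->|tn] := eqVneq t 0; first by rewrite mul0r subr0 mul1r addr0.
  have t0' : 0 < t by rewrite lt_neqAle eq_sym tn.
  have : (1 - t) * `|y - x0| <= (1 - t) * (2 * r) by rewrite ler_wpM2l ?subr_ge0// ltW.
  have : t * `|x - x0| < t * (2 * r) by rewrite ltr_pM2l.
  by lra.
have [h [sh hy hf]] := hadamard oW star (NW _ Nq) (hat f).
(* Each factor is extended by cutoff, so [F] is a global function that agrees with [f] only on [N];
   locality of [Y] makes this enough. *)
pose F : S := f q *: (1 : S) + \sum_j (coord j - y ord0 j *: (1 : S)) * ext (sh j).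
rewrite (_ : Y f q = Y F q).
  rewrite vfD vfZ vf1 scaler0 add0r vf_sum sfun_sumE; apply: eq_bigr => j _.
  rewrite vf_leibniz vfB vfZ vf1 scaler0 subr0 !sfunE !extE//.
  by rewrite -/y mulr1 subrr mul0r addr0 hy.
apply: (@vf_local Y f F N q) => //; first exact: open_point_ball.
move=> p Np; have [cp _] := Np.
have := hf _ (NW _ Np); rewrite /= /y !cmapK ?inE// => ->.
rewrite [RHS](_ : _ = f q * 1 + (\sum_j (coord j - y ord0 j *: (1 : S)) * ext (sh j) : S) p)//.
rewrite sfun_sumE mulr1; congr (_ + _); apply: eq_bigr => j _.
by rewrite !sfunE !extE// mulr1.
Qed.

Lemma chart_frame : exists (X : 'I_n -> S) (F : 'I_n -> V), forall q, N q ->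
  [/\ forall j, X j q = cmap c q ord0 j,
      forall i f, F i f q = 'D_(e_ i) (f \o cinv c) (cmap c q) &
      forall (Y : V) f, Y f q = \sum_j Y (X j) q * F j f q].
Proof.
exists coord, frame => q Nq; split=> [j|i f|Y f]; first exact: extE.
  exact: extE.
exact: chart_span.
Qed.

End Frame.

Record is_local_frame (p : M) (c : chart R n M) (r : R) (X : 'I_n -> S)
    (F : 'I_n -> V) : Prop := {
  frame_atlas : atlas M c;
  frame_radius : 0 < r;
  frame_center : cdom c p;
  frame_image : [set x | `|x - cmap c p| < r] `<=` cmap c @` cdom c;
  frame_coord : forall q, point_ball c (cmap c p) r q -> forall j, X j q = cmap c q ord0 j;
  frame_partial : forall q, point_ball c (cmap c p) r q -> forall i f,
    F i f q = 'D_(e_ i) (f \o cinv c) (cmap c q);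
  frame_span : forall q, point_ball c (cmap c p) r q -> forall (Y : V) f,
    Y f q = \sum_j Y (X j) q * F j f q }.

Lemma exists_local_frame (p : M) : exists c r X F, is_local_frame p c r X F.
Proof.
have [c [r [chi [B cp _]]]] := exists_chart_ball openT (I : setT p).
have [X [F XF]] := chart_frame B; have r0 := ball_radius B.
exists c, (r / 2), X, F; split=> //; first exact: ball_atlas B.
- by rewrite divr_gt0.
- by move=> x /= xr; apply: (ball_image B) => /=; apply: lt_trans xr _; lra.
- by move=> q /XF[].
- by move=> q /XF[].
- by move=> q /XF[].
Qed.

End ChartFrame.

(** * Second derivatives at a maximum, parallel symmetric forms *)

Section RealLine.
Context {R : realType}.
Implicit Types (h : R -> R).

Lemma derive_neg_left h (t d : R) : is_derive t (1 : R) h d -> d < 0 ->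
  exists2 e, 0 < e & forall s, t - e < s < t -> h t < h s.
Proof.
move=> [dh he] d0.
have L : (fun k : R => k^-1 *: (h (k *: 1 + t) - h t)) k @[k --> 0^'] --> d.
  by rewrite -he; exact: dh.
have nd : 0 < - d by rewrite oppr_gt0.
have /cvgrPdist_lt/(_ _ nd) [e /= e0 P] := L.
exists e => // s /andP[s1 s2].
have st : s - t < 0 by rewrite subr_lt0.
have := P (s - t); rewrite /= sub0r normrN ltr0_norm// lt_eqF// => /(_ ltac:(lra) isT).
rewrite [_ *: 1]mulr1 subrK ltr_norml => /andP[hd _].
have {}hd : (s - t)^-1 *: (h s - h t) < 0 by lra.
move: hd; rewrite [X in X < _]/(_ * _) nmulr_rlt0 ?invr_lt0//.
by rewrite subr_gt0.
Qed.

Lemma derive_ge0_left h (t d e : R) : 0 < e -> is_derive t (1 : R) h d ->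
  (forall s, t - e < s < t -> h s <= h t) -> 0 <= d.
Proof.
move=> e0 dh hle; rewrite leNgt; apply/negP => /(derive_neg_left dh)[e' e'0 hlt].
pose m := Num.min e e'.
have m0 : 0 < m by rewrite lt_min e0.
have [me me'] : m <= e /\ m <= e' by rewrite !ge_min !lexx orbT.
have := hle (t - m / 2); have := hlt (t - m / 2).
have -> : t - e' < t - m / 2 < t by apply/andP; split; lra.
have -> : t - e < t - m / 2 < t by apply/andP; split; lra.
by move=> /(_ isT) a /(_ isT); rewrite leNgt a.
Qed.

(** If [d2] were positive, [dh], which vanishes at 0, would be negative just to the left of 0, and
    [h] would take values above [h 0] there. *)
Lemma second_derivative_max h dh (d2 e : R) : 0 < e ->
  (forall t : R, `|t| < e -> is_derive t (1 : R) h (dh t)) -> is_derive (0 : R) (1 : R) dh d2 ->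
  (forall t : R, `|t| < e -> h t <= h 0) -> dh 0 = 0 /\ d2 <= 0.
Proof.
move=> e0 dhP d2P hmax.
have n0 : `|0 : R| < e by rewrite normr0.
have dge0 : 0 <= dh 0.
  apply: (derive_ge0_left e0 (dhP 0 n0)) => s /andP[s1 s2].
  by apply: hmax; rewrite ltr_norml; lra.
have dle0 : dh 0 <= 0.
  have h' : is_derive (0 : R) (1 : R) (fun t => h (- t)) (- dh 0).
    have d1 : is_derive (0 : R) (1 : R) (fun t : R => - t) (- 1) by exact: is_deriveN.
    have hN : is_derive (- 0 : R) (1 : R) h (dh 0) by rewrite oppr0; exact: dhP.
    have := @is_derive1_comp _ h (fun t => - t) 0 _ _ hN d1.
    by rewrite mulrN1.
  rewrite -oppr_ge0; apply: (derive_ge0_left e0 h') => s /andP[s1 s2].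
  by rewrite oppr0; apply: hmax; rewrite ltr_norml; lra.
have dh0 : dh 0 = 0 by apply/eqP; rewrite eq_le dle0.
split=> //; rewrite leNgt; apply/negP => lt0.
have nd : is_derive (0 : R) (1 : R) (fun t => - dh t) (- d2) by exact: is_deriveN.
have [e' e'0 dneg] := derive_neg_left nd ltac:(lra).
pose m := Num.min e e'.
have m0 : 0 < m by rewrite lt_min e0.
have [me me'] : m <= e /\ m <= e' by rewrite !ge_min !lexx orbT.
have m2 : - (m / 2) < 0 by lra.
have dI s : s \in `]- (m / 2), 0[ -> is_derive s (1 : R) h (dh s).
  by rewrite in_itv /= => /andP[s1 s2]; apply: dhP; rewrite ltr_norml; lra.
have cI : {within `[- (m / 2), 0], continuous h}.
  apply: derivable_within_continuous => s; rewrite in_itv /= => /andP[s1 s2].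
  by apply: ex_derive; apply: dhP; rewrite ltr_norml; lra.
have [s sm hs] := MVT m2 dI cI.
move: sm; rewrite in_itv /= => /andP[s1 s2].
have := dneg s; rewrite dh0 oppr0 => /(_ ltac:(lra)); rewrite oppr_gt0 => dsneg.
have := hmax (- (m / 2)); rewrite ltr_norml => /(_ ltac:(lra)).
rewrite -subr_ge0 hs leNgt => /negP; apply; rewrite nmulr_rlt0// ; lra.
Qed.

End RealLine.

(** * Function-linear forms on vector fields *)

Section Tensors.
Context {R : realType} {n : nat} {M : manifold R n}.
Local Notation S := (sfun M).
Local Notation V := (vfield M).
Implicit Types (T : V -> S).

Definition slinear T := forall (u : S) X Y, T (u *: X + Y) = u * T X + T Y.

Lemma slinear0 T : slinear T -> T 0 = 0.
Proof.
by move=> lT; apply: (@addIr _ (T 0)); rewrite add0r; have := lT 1 0 0;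
  rewrite scale1r addr0 mul1r => <-.
Qed.

Lemma slinearD T X Y : slinear T -> T (X + Y) = T X + T Y.
Proof. by move=> lT; rewrite -{1}(scale1r X) lT mul1r. Qed.

Lemma slinearZ T u X : slinear T -> T (u *: X) = u * T X.
Proof. by move=> lT; rewrite -[u *: X]addr0 lT slinear0// addr0. Qed.

Lemma slinearN T X : slinear T -> T (- X) = - T X.
Proof. by move=> lT; rewrite -scaleN1r slinearZ// mulN1r. Qed.

Lemma slinearB T X Y : slinear T -> T (X - Y) = T X - T Y.
Proof. by move=> lT; rewrite slinearD// slinearN. Qed.

Lemma slinear_sum T (I : Type) (r : seq I) (F : I -> V) : slinear T ->
  T (\sum_(i <- r) F i) = \sum_(i <- r) T (F i).
Proof.
move=> lT; apply: (big_morph T _ (slinear0 lT)) => X Y; exact: slinearD.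
Qed.

(** For a bump [chi] supported in [O], the field [chi *: X] is globally zero, while [T] of it has
    the value of [T X] at [q]. *)
Lemma slinear_local T X (O : set M) q : slinear T -> open O -> O q ->
  (forall p, O p -> vanishes_at X p) -> T X q = 0.
Proof.
move=> lT oO Oq X0; have [chi [c1 c0]] := exists_sfun_bump oO Oq.
have : chi *: X = 0.
  apply: vfield_eqP => f; apply: sfun_eqP => p; rewrite vfieldZE !sfunE.
  by have [Op|/c0 ->] := pselect (O p); rewrite ?mul0r// X0// mulr0.
move=> /(congr1 (fun Y => T Y q)); rewrite slinearZ// slinear0// !sfunE c1 mul1r.
by [].
Qed.

End Tensors.

(** * Constant-coefficient fields, chart lines and the second derivative test *)

Section LocalFrame.
Context {R : realType} {n : nat} {M : manifold R n}.
Local Notation E := 'rV[R]_n.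
Local Notation e_ i := (delta_mx ord0 i : E).
Local Notation S := (sfun M).
Local Notation V := (vfield M).
Variables (p : M) (c : chart R n M) (r : R) (X : 'I_n -> S) (F : 'I_n -> V).
Local Notation x0 := (cmap c p).
Local Notation N := (point_ball c x0 r).
Hypothesis (LF : is_local_frame p c r X F).

Definition const_field (w : E) : V := \sum_i (w ord0 i *: (1 : S)) *: F i.

Lemma const_fieldE w f q : const_field w f q = \sum_i w ord0 i * F i f q.
Proof.
rewrite /const_field vfield_sumE sfun_sumE; apply: eq_bigr => i _.
by rewrite vfieldZE sfun_scaleM mul1r.
Qed.

Lemma slinear_const_field T w q : slinear T -> T (const_field w) q = \sum_i w ord0 i * T (F i) q.
Proof.
move=> lT; rewrite slinear_sum// sfun_sumE; apply: eq_bigr => i _.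
by rewrite slinearZ// sfun_scaleM mul1r.
Qed.

Definition chart_line (a : E) (t : R) : M := cinv c (x0 + t *: a).

Lemma chart_line0 a : chart_line a 0 = p.
Proof. by rewrite /chart_line scale0r addr0 cmapK// inE; exact: frame_center LF. Qed.

Lemma chart_line1 q : cdom c q -> chart_line (cmap c q - x0) 1 = q.
Proof. by move=> cq; rewrite /chart_line scale1r subrKC cmapK ?inE. Qed.

Lemma chart_line_in a t : `|t *: a| < r -> N (chart_line a t) /\ cmap c (chart_line a t) =
  x0 + t *: a.
Proof.
move=> ta; have : [set x | `|x - x0| < r] (x0 + t *: a) by rewrite /= addrC addKr.
move=> /[dup] xr /(frame_image LF)/chart_cinv[cq e]; split=> //; split=> //.
by rewrite e.
Qed.

Lemma is_derive_chart_line a t (f : S) : `|t *: a| < r ->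
  is_derive t (1 : R) (f \o chart_line a) (const_field a f (chart_line a t)).
Proof.
move=> ta; have [Nt e] := chart_line_in ta.
pose W := [set x : E | `|x - x0| < r].
have oW : open W.
  rewrite [X in open X](_ : _ = ball x0 r); first exact: ball_open.
  by rewrite -ball_normE /W; apply/seteqP; split => x /=; rewrite distrC.
have Wt : W (x0 + t *: a) by rewrite /W /= addrC addKr.
have C1 : Ck_on 1 W (f \o cinv c) by exact: (Ck_on_sub (frame_image LF) (sfun_smooth f
  (frame_atlas LF) 1)).
rewrite const_fieldE; under eq_bigr => i _ do rewrite (frame_partial LF)// e.
apply: (@is_derive_curve R n W R (f \o cinv c) (fun s => x0 + s *: a) t 1
  (fun j => a ord0 j) oW Wt C1) => j.
have := @is_derive_line R R id (x0 ord0 j) (a ord0 j) t.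
rewrite derive_id => /(_ (@derivable_id _ _ _ _)).
by congr (is_derive _ _ _ _); apply/funext => s; rewrite !mxE.
Qed.

Lemma open_frame_ball : open N.
Proof. exact: open_point_ball. Qed.

Lemma slinear_frame T Y q : slinear T -> N q -> T Y q = \sum_j Y (X j) q * T (F j) q.
Proof.
move=> lT Nq.
have : T (Y - \sum_j Y (X j) *: F j) q = 0.
  apply: (slinear_local lT open_frame_ball Nq) => q' Nq' f.
  rewrite vfieldDE vfieldNE vfield_sumE !sfunE sfun_sumE (frame_span LF Nq' Y f).
  by rewrite subrr.
rewrite slinearB// slinear_sum// sfunBE sfun_sumE => /eqP; rewrite subr_eq0 => /eqP ->.
by apply: eq_bigr => j _; rewrite slinearZ.
Qed.

Lemma frame_center_in : N p.
Proof. by split; [exact: frame_center LF|rewrite subrr normr0; exact: frame_radius LF]. Qed.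

Lemma vf_frame (Y : V) (T : S) : Y T p = const_field (\row_j Y (X j) p) T p.
Proof.
rewrite const_fieldE (frame_span LF frame_center_in); by apply: eq_bigr => j _; rewrite mxE.
Qed.

(** At a critical point the second derivative along [Y] depends only on the value of [Y] at [p]: the
    term differentiating the coefficients of [Y] is multiplied by a first derivative of [phi], which
    is 0. So [Y] may be replaced by a constant-coefficient field, for which this is a second
    derivative along a chart line. *)
Lemma max_second_derivative (phi : S) : (forall q, phi q <= phi p) -> forall Y : V,
  Y phi p = 0 /\ Y (Y phi) p <= 0.
Proof.
move=> phimax.
have key a : const_field a phi p = 0 /\ const_field a (const_field a phi) p <= 0.
  have a1 : 0 < `|a| + 1 by rewrite ltr_wpDl.
  have e0 : 0 < r / (`|a| + 1) by rewrite divr_gt0 ?(frame_radius LF).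
  have near0 (t : R) : `|t| < r / (`|a| + 1) -> `|t *: a| < r.
    rewrite normrZ ltr_pdivlMr// => ta; apply: le_lt_trans ta.
    by rewrite ler_wpM2l// lerDl.
  have := @second_derivative_max R (phi \o chart_line a)
    (const_field a phi \o chart_line a) (const_field a (const_field a phi) p) _ e0.
  rewrite /= !chart_line0; apply.
  - by move=> t /near0; exact: is_derive_chart_line.
  - rewrite -[X in const_field a _ X](chart_line0 a); apply: is_derive_chart_line.
    by rewrite scale0r normr0; exact: frame_radius LF.
  - by move=> t _; exact: phimax.
have crit (Y : V) : Y phi p = 0 by rewrite vf_frame; have [] := key (\row_j Y (X j) p).
move=> Y; split=> //; pose a := \row_j Y (X j) p.
have [_] := key a; rewrite (vf_frame Y) -/a.
suff -> : const_field a (Y phi) p = const_field a (const_field a phi) p by [].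
have -> : const_field a (Y phi) p = const_field a (\sum_j Y (X j) * F j phi) p.
  apply: (vf_local _ open_frame_ball frame_center_in) => q Nq.
  by rewrite (frame_span LF Nq) sfun_sumE.
have -> : const_field a phi = \sum_j a ord0 j *: F j phi.
  by apply: sfun_eqP => q; rewrite const_fieldE sfun_sumE.
rewrite !vf_sum !sfun_sumE; apply: eq_bigr => j _.
by rewrite vf_leibniz vfZ !sfunE crit mulr0 add0r mxE.
Qed.

End LocalFrame.

(** * Propagation of the sign of a parallel symmetric form in a chart *)

Section Propagation.
Context {R : realType} {n : nat} {M : manifold R n}.
Local Notation E := 'rV[R]_n.
Local Notation e_ i := (delta_mx ord0 i : E).
Local Notation S := (sfun M).
Local Notation V := (vfield M).
Variables (p : M) (c : chart R n M) (r : R) (X : 'I_n -> S) (F : 'I_n -> V).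
Hypothesis (LF : is_local_frame p c r X F).
Local Notation N := (point_ball c (cmap c p) r).
Local Notation const_field := (const_field F).
Local Notation chart_line := (chart_line p c).
Variables (D : V -> V -> V) (b : V -> V -> S).
Hypotheses (D_add : forall Z Y1 Y2 : V, D Z (Y1 + Y2) = D Z Y1 + D Z Y2)
  (D_leibniz : forall (u : S) (Z Y : V), D Z (u *: Y) = Z u *: Y + u *: D Z Y)
  (b_sym : forall Y Z : V, b Y Z = b Z Y) (b_lin : forall Z : V, slinear (b^~ Z))
  (b_parallel : forall W Y Z : V, W (b Y Z) = b (D W Y) Z + b Y (D W Z)).

Let D0 Z : D Z 0 = 0.
Proof. by apply: (@addIr _ (D Z 0)); rewrite -D_add !add0r. Qed.

Let D_const_field Z w : D Z (const_field w) = \sum_i (w ord0 i *: (1 : S)) *: D Z (F i).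
Proof.
rewrite /const_field (big_morph (D Z) (D_add Z) (D0 Z)); apply: eq_bigr => i _.
by rewrite D_leibniz vfZ vf1 scaler0 scale0r add0r.
Qed.

Let b_linr Z : slinear (b Z).
Proof. by move=> u Y1 Y2; rewrite b_sym b_lin (b_sym Y1) (b_sym Y2). Qed.

Let const_fieldD w w' : const_field (w + w') = const_field w + const_field w'.
Proof.
rewrite /const_field -big_split; apply: eq_bigr => i _ /=.
by rewrite mxE scalerDl scalerDl.
Qed.

Let const_fieldZ s w : const_field (s *: w) = (s *: (1 : S)) *: const_field w.
Proof.
rewrite /const_field scaler_sumr; apply: eq_bigr => i _.
by rewrite mxE !scalerA sfun_scaleM mul1r scalerA.
Qed.

Let const_field_delta l : const_field (e_ l) = F l.
Proof.
rewrite /const_field (bigD1 l)//= mxE !eqxx /= !scale1r big1 ?addr0// => i il.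
by rewrite mxE eqxx (negPf il) scale0r scale0r.
Qed.

Let B w q := b (const_field w) (const_field w) q.

Let BZ s w q : B (s *: w) q = s ^+ 2 * B w q.
Proof.
by rewrite /B const_fieldZ (slinearZ _ _ (b_lin _)) (slinearZ _ _ (b_linr _)) !sfun_scaleM !mul1r
  !sfunZE mulrA.
Qed.

Let B0 q : B 0 q = 0.
Proof. by have := BZ 0 0 q; rewrite scaler0 expr0n mul0r. Qed.

Let BDdelta w s l q :
  B (w + s *: e_ l) q = B w q + s * (b (F l) (const_field w) q *+ 2) + s ^+ 2 * b (F l) (F l) q.
Proof.
rewrite /B const_fieldD const_fieldZ const_field_delta.
rewrite (slinearD _ _ (b_lin _)) !(slinearD _ _ (b_linr _)).
rewrite !(slinearZ _ _ (b_lin _)) !(slinearZ _ _ (b_linr _)) (b_sym (const_field w) (F l)).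
by rewrite !sfun_scaleM !mul1r !sfunE mulr2n; ring.
Qed.

Let BE w q : B w q = \sum_i w ord0 i * \sum_j w ord0 j * b (F i) (F j) q.
Proof.
rewrite /B (slinear_const_field _ _ _ (b_lin _)); apply: eq_bigr => i _.
by rewrite (slinear_const_field _ _ _ (b_linr _)).
Qed.

(** The Euclidean square norm: a maximizer of a quadratic form on its unit sphere is an eigenvector,
    which fails for the maximum norm carried by [E]. *)
Let sqn (w : E) := \sum_i w ord0 i ^+ 2.

Let sqn_ge0 w : 0 <= sqn w.
Proof. by apply: sumr_ge0 => i _; exact: sqr_ge0. Qed.

Let sqn_eq0 w : sqn w = 0 -> w = 0.
Proof.
move=> /eqP; rewrite psumr_eq0 => [/allP w0|i _]; last exact: sqr_ge0.
apply/rowP => i; rewrite mxE; apply/eqP; rewrite -sqrf_eq0.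
by apply: (w0 i); rewrite mem_index_enum.
Qed.

Let sqnZ s w : sqn (s *: w) = s ^+ 2 * sqn w.
Proof. by rewrite /sqn mulr_sumr; apply: eq_bigr => i _; rewrite mxE exprMn. Qed.

Let sqnDdelta w s l : sqn (w + s *: e_ l) = sqn w + s * (w ord0 l *+ 2) + s ^+ 2.
Proof.
rewrite /sqn (bigD1 l)//= (bigD1 l (P := predT) (F := fun i =>
  w ord0 i ^+ 2))//= !mxE !eqxx mulr1.
under eq_bigr => i il do rewrite !mxE eqxx (negPf il) mulr0 addr0.
by rewrite mulr2n; ring.
Qed.

Let coord_le1 w i : sqn w = 1 -> `|w ord0 i| <= 1.
Proof.
move=> w1; rewrite -[leRHS]normr1 -ler_sqr ?nnegrE// !real_normK ?num_real// expr1n -w1.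
by rewrite /sqn (bigD1 i)//= lerDl; apply: sumr_ge0 => j _; exact: sqr_ge0.
Qed.

(** The first-order condition at a maximum, for a quadratic polynomial in [s]; the test value below
    makes the linear term dominate. *)
Lemma linear_coef_eq0 (al be : R) : (forall s, s * al <= s ^+ 2 * be) -> al = 0.
Proof.
move=> h; apply/eqP; apply: contraT => al0.
have b1 : 0 < `|be| + 1 by rewrite ltr_wpDl.
have := h (al / (`|be| + 1)).
have -> : (al / (`|be| + 1)) ^+ 2 * be = (al / (`|be| + 1)) * al * (be / (`|be| + 1)) by rewrite
  expr2; field; rewrite gt_eqF.
have a2 : 0 < al / (`|be| + 1) * al by rewrite mulrAC divr_gt0// -expr2 exprn_even_gt0.
rewrite -[X in X <= _]mulr1 ler_pM2l// ler_pdivlMr// mul1r leNgt.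
by rewrite (le_lt_trans (ler_norm be))// ltrDl.
Qed.

Let sphere : set E := [set w | sqn w = 1].

Let compact_sphere : compact sphere.
Proof.
apply: bounded_closed_compact.
  exists 1; split; first exact: num_real.
  move=> y y1 w /= w1; apply: le_trans (ltW y1); apply: normr_rV_le => // j.
  exact: coord_le1.
have cs : continuous sqn.
  have -> : sqn = (fun w => \sum_i ((fun w : E => w ord0 i) * (fun w : E => w ord0 i)) w).
    by apply/funext => w; apply: eq_bigr => i _; rewrite expr2.
  have C : Ck_on 0 [set: E] (fun w => \sum_i ((fun w : E => w ord0 i) * (fun w : E =>
    w ord0 i)) w).
    by apply: Ck_on_sum => [|i]; [exact: openT|apply: Ck_onM (openT) _ _; exact: Ck_on_coord].
  by move=> w; apply: (Ck_on_continuous C); rewrite inE.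
by apply: (closed_comp (f := sqn) (D := [set 1])) => [w _|]; [exact: cs|exact: closed_eq].
Qed.

(** Suppose [b] takes a positive value at [q]. Over the times in [0, 1] and the unit coefficient
    vectors, [exp (- C t)] times the quadratic form at [g t] has a positive maximum, attained at a
    time [t1 > 0] because [b] is nonpositive at [p]. By parallelism and the eigenvector equation,
    the time derivative at the maximum is the maximum times [- C] plus a connection term. For [C]
    large it is negative, so earlier values would be larger. *)
Lemma nonpos_propagates q : N q -> (forall Y, b Y Y p <= 0) -> forall Y, b Y Y q <= 0.
Proof.
move=> Nq bp Y; rewrite leNgt; apply/negP => bq.
have [cq qr] := Nq.
pose a := cmap c q - cmap c p.
have ta (t : R) : 0 <= t <= 1 -> `|t *: a| < r.
  move=> /andP[t0 t1]; rewrite normrZ ger0_norm//; apply: le_lt_trans qr.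
  by rewrite ler_piMl.
pose g := chart_line a.
have gN (t : R) : 0 <= t <= 1 -> N (g t) by move=> /ta /(chart_line_in LF)[].
have dline (f : S) (t : R) : 0 <= t <= 1 -> is_derive t (1 : R) (f \o g) (const_field a f (g t)).
  by move=> /ta; exact: (is_derive_chart_line LF).
have cline (f : S) (t : R) : 0 <= t <= 1 -> {for t, continuous (f \o g)}.
  by move=> /(dline f) d; apply/differentiable_continuous/derivable1_diffP; exact: ex_derive.
(* The connection coefficients in the direction of the segment: components in the frame of the
   derivative of [F i] along [a]. *)
pose Gam i l := D (const_field a) (F i) (X l).
have [K KP] : exists K : 'I_n -> 'I_n -> R, forall i l (t : R), 0 <= t <= 1 -> `|Gam i l (g t)|
  <= K i l.
  have K1 i l : exists k : R, forall t : R, 0 <= t <= 1 -> `|Gam i l (g t)| <= k.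
    have cG : {within `[0, 1], continuous (fun t : R => `|Gam i l (g t)|)}.
      apply: continuous_in_subspaceT => t /set_mem; rewrite /= in_itv /= => t01.
      by apply: continuous_comp (cline (Gam i l) t t01) _; exact: norm_continuous.
    have [k _ kP] := EVT_max ler01 cG.
    by exists `|Gam i l (g k)| => t t01; apply: kP; rewrite in_itv.
  have [K KP] := choice (fun il : 'I_n * 'I_n => K1 il.1 il.2).
  by exists (fun i l => K (i, l)) => i l; exact: (KP (i, l)).
(* Unit vectors have coordinates of absolute value at most 1, so twice the double sum bounds the
   connection term; the extra 1 makes the inequality strict. *)
pose C := 1 + 2 * \sum_i \sum_l K i l.
pose beta i j (t : R) := b (F i) (F j) (g t).
pose H (tw : R * E) := expR (- C * tw.1) * B tw.2 (g tw.1).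
have dB (w : E) (t : R) : 0 <= t <= 1 -> is_derive t (1 : R) (B w \o g)
    (2 * \sum_l (\sum_i w ord0 i * Gam i l (g t)) * b (F l) (const_field w) (g t)).
  move=> t01; have := dline (b (const_field w) (const_field w)) t t01.
  move=> d; apply: (is_derive_eq d).
  rewrite b_parallel (b_sym (const_field w) (D _ _)) !sfunE.
  rewrite -[LHS]mulr2n -[LHS]mulr_natl; congr (_ * _).
  rewrite (slinear_frame LF _ (b_lin (const_field w)) (gN _ t01)).
  apply: eq_bigr => l _; congr (_ * _).
  rewrite D_const_field vfield_sumE sfun_sumE; apply: eq_bigr => i _.
  by rewrite vfieldZE sfun_scaleM mul1r.
pose A : set (R * E) := `[0, 1]%classic `*` sphere.
have cA : compact A by apply: compact_setX; [exact: segment_compact|exact: compact_sphere].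
have cH : {within A, continuous H}.
  apply: continuous_in_subspaceT => -[t w] /set_mem [/= + _]; rewrite in_itv /= => t01.
  have cbeta i j : beta i j p0.1 @[p0 --> (t, w)] --> beta i j t.
    apply: (@cvg_comp _ _ _ (fun p0 : R * E => p0.1) (beta i j)); first exact: cvg_fst.
    exact: (cline (b (F i) (F j)) t t01).
  have ccoord (i : 'I_n) : (fun p0 : R * E => p0.2 ord0 i : R) p0 @[p0 --> (t, w)] --> w ord0 i.
    apply: (@cvg_comp _ _ _ (fun p0 : R * E => p0.2) (fun w : E => w ord0 i));
      first exact: cvg_snd.
    exact: (@coord_continuous R 1 n ord0 i w).
  (* Written as a polynomial in the coordinates of [w] with coefficients depending on the time
     alone, [H] is visibly continuous in both variables jointly. *)
  rewrite [H](_ : _ = (fun tw : R * E => expR (- C * tw.1) *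
      \sum_i tw.2 ord0 i * \sum_j tw.2 ord0 j * beta i j tw.1)); last first.
    by apply/funext => tw; rewrite /H BE.
  apply: cvgM.
    have ce : {for t, continuous (fun t : R => expR (- C * t))}.
      by apply: continuous_comp; [exact: mulrl_continuous|exact: continuous_expR].
    apply: (@cvg_comp _ _ _ (fun p0 : R * E => p0.1) (fun t : R => expR (- C * t)));
      first exact: cvg_fst.
    exact: ce.
  apply: (@cvg_big _ _ _ _ _ _ _ _ _ (fun i (tw : R * E) =>
    tw.2 ord0 i * \sum_j tw.2 ord0 j * beta i j tw.1)) => [|i _].
    exact: add_continuous.
  apply: cvgM; first exact: ccoord.
  apply: (@cvg_big _ _ _ _ _ _ _ _ _ (fun j (tw : R * E) => tw.2 ord0 j * beta i j tw.1)) =>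
    [|j _].
    exact: add_continuous.
  by apply: cvgM; [exact: ccoord|exact: cbeta].
pose w0 : E := \row_j Y (X j) q.
have g1 : g 1 = q by exact: (chart_line1 p cq).
have bY : b Y Y q = B w0 (g 1).
  rewrite g1 BE (slinear_frame LF _ (b_lin Y) Nq); apply: eq_bigr => i _; rewrite mxE;
    congr (_ * _).
  by rewrite (slinear_frame LF _ (b_linr (F i)) Nq); apply: eq_bigr => j _; rewrite mxE.
have s0 : 0 < sqn w0.
  rewrite lt_neqAle sqn_ge0 andbT eq_sym; apply/eqP => /sqn_eq0 w00.
  by move: bq; rewrite bY w00 B0 ltxx.
pose unit (w : E) : E := (Num.sqrt (sqn w))^-1 *: w.
have unitP w : 0 < sqn w -> sphere (unit w).
  by move=> sw; rewrite /sphere /= sqnZ exprVn sqr_sqrtr ?ltW// mulVf// gt_eqF.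
have unitB w z : 0 < sqn w -> B (unit w) z = B w z / sqn w.
  by move=> sw; rewrite BZ exprVn sqr_sqrtr ?ltW// mulrC.
have A1 : A (1, unit w0) by split; [rewrite /= in_itv /= lexx ler01|exact: unitP].
have [[t1 w1] /set_mem[/= t01 w1s] Hmax] := compact_EVT_max (ex_intro _ _ A1) cA cH.
rewrite in_itv /= in t01.
have Hle (t : R) w : 0 <= t <= 1 -> sphere w -> expR (- C * t) * B w (g t) <= expR (- C * t1) * B
  w1 (g t1).
  by move=> tt ws; apply: (Hmax (t, w)); rewrite inE; split=> //=; rewrite in_itv.
pose la := B w1 (g t1).
have la0 : 0 < la.
  have : 0 < expR (- C * t1) * la.
    apply: lt_le_trans (Hle 1 (unit w0) _ (unitP _ s0)); last by rewrite lexx ler01.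
    by rewrite unitB// mulr_gt0 ?expR_gt0// divr_gt0// -bY.
  by rewrite pmulr_rgt0// expR_gt0.
have t1gt0 : 0 < t1.
  rewrite lt_neqAle eq_sym; have /andP[-> _] := t01; rewrite andbT; apply/eqP => t10.
  by move: la0; rewrite /la t10 /g (chart_line0 LF) ltNge /B bp.
have quad w : B w (g t1) <= la * sqn w.
  have [sw|] := ltP 0 (sqn w).
    by rewrite -ler_pdivrMr// -unitB//; have := Hle t1 _ t01 (unitP _ sw); rewrite ler_pM2l//
      expR_gt0.
  move=> /(conj (sqn_ge0 w))/andP; rewrite -eq_le eq_sym => /eqP sw.
  by rewrite sw mulr0 (sqn_eq0 sw) B0.
(* [w1] maximizes [b] on the unit sphere at [g t1], hence is an eigenvector there *)
have eig l : b (F l) (const_field w1) (g t1) = la * w1 ord0 l.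
  apply/eqP; rewrite -subr_eq0; apply/eqP.
  apply: (@linear_coef_eq0 _ ((la - b (F l) (F l) (g t1)) / 2)) => s.
  have := quad (w1 + s *: e_ l); rewrite BDdelta sqnDdelta -/la (_ : sqn w1 = 1)//.
  rewrite -subr_ge0 => h; rewrite -subr_ge0.
  apply: le_trans (_ : 0 <= 2^-1 * _) _; first by apply: mulr_ge0 h; rewrite invr_ge0.
  by rewrite le_eqVlt; apply/orP; left; apply/eqP; rewrite !mulr2n; field.
have dH : is_derive t1 (1 : R) (fun t => H (t, w1)) (expR (- C * t1) * la * (- C +
    2 * \sum_l (\sum_i w1 ord0 i * Gam i l (g t1)) * w1 ord0 l)).
  have de : is_derive t1 (1 : R) (fun t : R => expR (- C * t)) (expR (- C * t1) * - C).
    have dl : is_derive t1 (1 : R) (fun t : R => - C * t) (- C).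
      have := @is_deriveZ R R R id (- C) t1 1 1 (is_derive_id _ _).
      by rewrite (_ : - C *: (1 : R) = - C)//; exact: mulr1.
    exact: (@is_derive_comp1 R R expR (fun t => - C * t) t1 1 _ _ (is_derive_expR _) dl).
  have := is_deriveM de (dB w1 t1 t01); move=> d; apply: (is_derive_eq d).
  under eq_bigr => l _ do rewrite eig.
  transitivity (expR (- C * t1) * (2 * \sum_l (\sum_i w1 ord0 i * Gam i l (g t1)) * (la * w1 ord0
    l))
    + la * (expR (- C * t1) * - C)); first by [].
  under eq_bigr => l _ do rewrite mulrCA.
  by rewrite -mulr_sumr; ring.
have Hge : 0 <= expR (- C * t1) * la * (- C +
    2 * \sum_l (\sum_i w1 ord0 i * Gam i l (g t1)) * w1 ord0 l).
  (* Only times before [t1] may be compared, since [t1] can be 1; the interval of length [t1] to its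
     left stays within [0, 1]. *)
  apply: (derive_ge0_left t1gt0 dH) => s /andP[s1 s2]; rewrite /H /=.
  by apply: Hle => //; rewrite ltW/= ?(le_trans (ltW s2))//; move: s1; rewrite ?subrr//;
    case/andP: t01.
move: Hge; rewrite pmulr_rge0; last by rewrite mulr_gt0// expR_gt0.
apply/negP; rewrite -ltNge addrC subr_lt0 /C.
suff : \sum_l (\sum_i w1 ord0 i * Gam i l (g t1)) * w1 ord0 l <= \sum_i \sum_l K i l by lra.
rewrite exchange_big /=; apply: ler_sum => l _; rewrite mulr_suml; apply: ler_sum => i _.
rewrite mulrAC; apply: le_trans (ler_norm _) _; rewrite normrM -[leRHS]mul1r.
rewrite ler_pM// ?KP// normrM -[leRHS]mul1r ler_pM//; exact: coord_le1.
Qed.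

End Propagation.

(** * From charts to a compact connected manifold *)

Section Global.
Context {R : realType} {n : nat} {M : manifold R n}.
Local Notation S := (sfun M).
Local Notation V := (vfield M).

Lemma sfun_exists_max (f : S) (p : M) : compact [set: M] -> exists p0, forall q, f q <= f p0.
Proof.
move=> cM; have cf : {within [set: M], continuous f}.
  by apply: continuous_subspaceT; exact: sfun_continuous.
have [p0 _ p0max] := compact_EVT_max (ex_intro _ p I) cM cf.
by exists p0 => q; apply: p0max; rewrite inE.
Qed.

Lemma sfun_max_second_derivative (f : S) (p : M) : (forall q, f q <= f p) ->
  forall Y : V, Y f p = 0 /\ Y (Y f) p <= 0.
Proof.
by move=> fmax Y; have [c [r [X [F LF]]]] := exists_local_frame p;
  exact: (max_second_derivative LF).
Qed.

(** The set of points where [b] is nonpositive is open by propagation in a chart ball, and closed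
    because each [b Y Y], for a global field [Y], is continuous. *)
Lemma parallel_nonpos (D : V -> V -> V) (b : V -> V -> S) (p : M) :
  connected [set: M] ->
  (forall Z Y1 Y2 : V, D Z (Y1 + Y2) = D Z Y1 + D Z Y2) ->
  (forall (u : S) (Z Y : V), D Z (u *: Y) = Z u *: Y + u *: D Z Y) ->
  (forall Y Z : V, b Y Z = b Z Y) -> (forall Z : V, slinear (b^~ Z)) ->
  (forall W Y Z : V, W (b Y Z) = b (D W Y) Z + b Y (D W Z)) ->
  (forall Y, b Y Y p <= 0) -> forall q Y, b Y Y q <= 0.
Proof.
move=> conM Dadd Dleib bsym blin bpar bp q.
pose G := [set q | forall Y, b Y Y q <= 0].
suff GT : G = [set: M] by have : G q by rewrite GT.
apply: conM; first by exists p.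
- exists G; last by rewrite setTI.
  rewrite openE => q0 Gq0; have [c [r [X [F LF]]]] := exists_local_frame q0.
  have nN : nbhs q0 (point_ball c (cmap c q0) r).
    by apply: open_nbhs_nbhs; split; [exact: open_point_ball|exact: frame_center_in LF].
  by apply: filterS nN => q1 Nq1; exact: (nonpos_propagates LF Dadd Dleib bsym blin bpar Nq1).
- exists G; last by rewrite setTI.
  rewrite -openC openE => q0 /existsNP[Y /negP]; rewrite -ltNge => bY.
  have nY : nbhs q0 [set q1 | 0 < b Y Y q1] by exact: (@sfun_continuous _ _ _ (b Y Y) q0 _
    (lt_nbhsr bY)).
  by apply: filterS nY => q1 /= lt1 /(_ Y); rewrite leNgt lt1.
Qed.

End Global.

(** * Forms of degree at most two *)

Section SmallSets.

(** Type projections sum over sets of arguments; enumerating these sets makes the projections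
    explicit in degrees one and two. *)
Lemma sum_set_I1 (W : nmodType) (P : pred {set 'I_1}) (F : {set 'I_1} -> W) :
  \sum_(A | P A) F A = (if P finset.set0 then F finset.set0 else 0) + (if P [set: _]%SET then F
    [set: _]%SET else 0).
Proof.
rewrite big_mkcond (bigD1 finset.set0)//= (bigD1 [set: _]%SET)/=; last first.
  by apply/eqP => /finset.setP/(_ ord0); rewrite !inE.
rewrite big_pred0 ?addr0// => A; apply/negP => /andP[A0 AT].
have [A1|A1] := boolP (ord0 \in A).
  by case/eqP: AT; apply/finset.setP => i; rewrite ord1 inE.
by case/eqP: A0; apply/finset.setP => i; rewrite ord1 inE (negPf A1).
Qed.

Let o0 : 'I_2 := ord0.
Let o1 : 'I_2 := ord_max.

Lemma sum_set_I2 (W : nmodType) (P : pred {set 'I_2}) (F : {set 'I_2} -> W) :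
  \sum_(A | P A) F A = (if P finset.set0 then F finset.set0 else 0) + ((if P [set ord0]%SET then
    F [set ord0]%SET else 0) +
   ((if P [set ord_max]%SET then F [set ord_max]%SET else 0) + (if P [set: _]%SET then F [set:
     _]%SET else 0))).
Proof.
have ne (A B : {set 'I_2}) i : (i \in A) != (i \in B) -> A != B.
  by apply: contraNneq => ->.
rewrite big_mkcond (bigD1 finset.set0)//= (bigD1 [set ord0]%SET)/=; last by apply: (ne _ _ o0);
  rewrite !inE.
rewrite (bigD1 [set ord_max]%SET)/=; last first.
  by rewrite (ne _ _ o1) ?inE//= (ne _ _ o0) ?inE.
rewrite (bigD1 [set: _]%SET)/=; last first.
  by rewrite (ne _ _ o0) ?inE//= (ne _ _ o1) ?inE//= (ne _ _ o0) ?inE.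
rewrite big_pred0 ?addr0// => A; apply/negP => /andP[/andP[/andP[A0 A1] A2] AT].
have I2 (i : 'I_2) : i = o0 \/ i = o1.
  by case: i => -[|[|//]] h; [left|right]; apply/val_inj.
have [h0|h0] := boolP (o0 \in A); have [h1|h1] := boolP (o1 \in A).
- by case/eqP: AT; apply/finset.setP => i; case: (I2 i) => ->; rewrite inE ?h0 ?h1.
- by case/eqP: A1; apply/finset.setP => i; case: (I2 i) => ->; rewrite inE ?h0 ?(negPf h1).
- by case/eqP: A2; apply/finset.setP => i; case: (I2 i) => ->; rewrite inE ?h1 ?(negPf h0).
- by case/eqP: A0; apply/finset.setP => i; case: (I2 i) => ->;
  rewrite inE ?(negPf h1) ?(negPf h0).
Qed.

Lemma card_set_I1 (A : {set 'I_1}) : #|A| = (ord0 \in A).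
Proof. by rewrite -sum1_card big_mkcond big_ord1; case: (_ \in _). Qed.

Lemma card_set_I2 (A : {set 'I_2}) : #|A| = ((ord0 \in A) + (ord_max \in A))%N.
Proof.
rewrite -sum1_card big_mkcond big_ord_recl big_ord1 (_ : lift ord0 ord0 = ord_max).
  by case: (ord0 \in A); case: (ord_max \in A).
exact/val_inj.
Qed.

Lemma exists_in_val k (T : {set 'I_k}) (i : 'I_k) : [exists j in T, val j == val i] = (i \in T).
Proof.
apply/existsP/idP => [[j /andP[jT /eqP ji]]|iT]; last by exists i; rewrite iT eqxx.
by rewrite -(val_inj ji).
Qed.

End SmallSets.

Lemma complex_axpy (R : rcfType) (u x y z w : R) :
  (u%:C * (x +i* y) + (z +i* w))%C = ((u * x + z) +i* (u * y + w))%C.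
Proof. by apply/eqP; rewrite eq_complex /=; apply/andP; split; apply/eqP; ring. Qed.

Section SmallForms.
Context {R : realType} {n : nat} {M : manifold R n}.
Local Notation S := (sfun M).
Local Notation CS := (csfun M).
Local Notation V := (vfield M).
Implicit Types (a b : V -> S) (al be : V -> V -> S) (F G : CS).

Lemma csfun_eqP F G : (forall p, F p = G p) -> F = G.
Proof. by move=> FG; apply/val_inj/funext. Qed.

Lemma csfun_ofE (f h : S) p : csfun_of f h p = (f p +i* h p)%C.
Proof. by []. Qed.
Lemma csfunDE F G p : (F + G) p = F p + G p. Proof. by []. Qed.
Lemma csfunZE (c : R[i]) F p : (c *: F) p = c * F p. Proof. by []. Qed.

Lemma csfun_of_inj (f h f' h' : S) : csfun_of f h = csfun_of f' h' -> f = f' /\ h = h'.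
Proof.
move=> e; split; apply: sfun_eqP => p; have := congr1 (fun F : CS => F p) e.
  by rewrite !csfun_ofE => -[].
by rewrite !csfun_ofE => -[].
Qed.

Lemma cderiv_csfun_of (X : V) (f h : S) : cderiv X (csfun_of f h) = csfun_of (X f) (X h).
Proof. by rewrite /cderiv; congr csfun_of; congr (X _); apply: sfun_eqP. Qed.

(** Complex forms are handled as pairs of real ones: [a] is the real part and [b] the imaginary
    part, and likewise for [form2]. *)
Definition form1 a b : form (M := M) := fun X => csfun_of (a (X 0)) (b (X 0)).
Definition form2 al be : form (M := M) := fun X => csfun_of (al (X 0) (X 1)) (be (X 0) (X 1)).

Lemma form2_inj al be al' be' : form2 al be = form2 al' be' ->
  forall X Y, al X Y = al' X Y /\ be X Y = be' X Y.
Proof.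
move=> e X Y; have := congr1 (fun om : form (M := M) => om (fun m => if m == 0 then X else Y)) e.
exact: csfun_of_inj.
Qed.

Lemma is_form1 a b : slinear a -> slinear b -> is_form 1 (form1 a b).
Proof.
move=> la lb; split=> [X Y XY|X i u Y Z p|X i j]; first by rewrite /form1 XY.
- rewrite ltnS leqn0 => /eqP -> /=; rewrite /form1 /= la lb.
  by rewrite complex_axpy.
- by move=> /andP[ij]; rewrite ltnS leqn0 => /eqP j0; rewrite j0 ltn0 in ij.
Qed.

Record is_2form al : Prop := {
  two_linear : forall Z, slinear (al^~ Z);
  two_antisym : forall X Y, al X Y = - al Y X }.

Lemma two_alternating al X : is_2form al -> al X X = 0.
Proof.
move=> [_ anti]; apply: sfun_eqP => p; have := congr1 (fun f : S => f p) (anti X X).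
by rewrite sfunNE sfun0E; lra.
Qed.

Lemma two_linear_r al Z : is_2form al -> slinear (al Z).
Proof.
by move=> [lin anti] u X Y; rewrite anti lin opprD -mulrN -anti -anti.
Qed.

Lemma is_form2 al be : is_2form al -> is_2form be -> is_form 2 (form2 al be).
Proof.
move=> al2 be2; split=> [X Y XY|X i u Y Z p|X i j]; first by rewrite /form2 !XY.
- rewrite ltnS leq_eqVlt ltnS leqn0 => /orP[]/eqP -> /=; rewrite /form2 /=.
    rewrite (two_linear_r _ al2) (two_linear_r _ be2).
    by rewrite complex_axpy.
  rewrite (two_linear al2) (two_linear be2).
  by rewrite complex_axpy.
- move=> /andP[]; case: j => [|[|j]] //; case: i => [|i] // _ _ X01.
  apply: csfun_eqP => p.
  by rewrite /form2 X01 (two_alternating _ al2) (two_alternating _ be2).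
Qed.

Variable J : {linear V -> V}.

Lemma twistE k (T : {set 'I_k}) (X : nat -> V) (i : 'I_k) :
  twist J T X i = if i \in T then J (X i) else X i.
Proof. by rewrite /twist exists_in_val. Qed.

Lemma form1_twist a b (T : {set 'I_1}) (X : nat -> V) (Y := if ord0 \in T then J (X 0) else X 0) :
  form1 a b (twist J T X) = csfun_of (a Y) (b Y).
Proof. by rewrite /form1 (twistE T X ord0). Qed.

Lemma form2_twist al be (T : {set 'I_2}) (X : nat -> V)
    (Y := if ord0 \in T then J (X 0) else X 0) (Z := if ord_max \in T then J (X 1) else X 1) :
  form2 al be (twist J T X) = csfun_of (al Y Z) (be Y Z).
Proof. by rewrite /form2 (twistE T X ord0) (twistE T X ord_max). Qed.

Let invr_complex k : (2 ^+ k)^-1 = ((2 ^+ k)^-1)%:C%C :> R[i].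
Proof. by rewrite fmorphV rmorphXn rmorph_nat. Qed.

Lemma type_proj_10 a b : type_proj J 1 0 (form1 a b) =
  form1 (fun X => 2^-1 *: (a X + b (J X))) (fun X => 2^-1 *: (b X - a (J X))).
Proof.
apply/funext => X; rewrite /type_proj invr_complex !sum_set_I1 !card_set_I1 !finset.inE /= ?add0r
  ?addr0 !form1_twist !finset.inE /=.
rewrite !(addn0, add0n, expr0, expr1, mul1r, mulr1).
apply: csfun_eqP => p; rewrite csfunZE csfunDE !csfunZE /form1 !csfun_ofE !sfunE.
by apply/eqP; rewrite eq_complex /=; apply/andP; split; apply/eqP; ring.
Qed.

Lemma type_proj_01 a b : type_proj J 0 1 (form1 a b) =
  form1 (fun X => 2^-1 *: (a X - b (J X))) (fun X => 2^-1 *: (b X + a (J X))).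
Proof.
apply/funext => X; rewrite /type_proj invr_complex !sum_set_I1 !card_set_I1 !finset.inE /= ?add0r
  ?addr0 !form1_twist !finset.inE /=.
rewrite !(addn0, add0n, expr0, expr1, mul1r, mulr1).
apply: csfun_eqP => p; rewrite csfunZE csfunDE !csfunZE /form1 !csfun_ofE !sfunE.
by apply/eqP; rewrite eq_complex /=; apply/andP; split; apply/eqP; ring.
Qed.

Lemma type_proj_20 al be : type_proj J 2 0 (form2 al be) =
  form2 (fun X Y => 4^-1 *: (al X Y - al (J X) (J Y) + be (J X) Y + be X (J Y)))
        (fun X Y => 4^-1 *: (be X Y - be (J X) (J Y) - al (J X) Y - al X (J Y))).
Proof.
apply/funext => X; rewrite /type_proj invr_complex !sum_set_I2 !card_set_I2 !finset.inE /= ?add0r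
  ?addr0 !form2_twist !finset.inE /=.
rewrite !(addn0, add0n, expr0, expr1, mul1r, mulr1).
apply: csfun_eqP => p; rewrite csfunZE !csfunDE !csfunZE /form2 !csfun_ofE !sfunE.
have -> : (2 ^+ (2 + 0))^-1 = 4^-1 :> R by rewrite addn0; field.
by apply/eqP; rewrite eq_complex /=; apply/andP; split; apply/eqP; ring.
Qed.

Lemma type_proj_11 al be : type_proj J 1 1 (form2 al be) =
  form2 (fun X Y => 2^-1 *: (al X Y + al (J X) (J Y)))
        (fun X Y => 2^-1 *: (be X Y + be (J X) (J Y))).
Proof.
apply/funext => X; rewrite /type_proj invr_complex !sum_set_I2 !card_set_I2 !finset.inE /= ?add0r
  ?addr0 !form2_twist !finset.inE /=.
rewrite !(addn0, add0n, expr0, expr1, mul1r, mulr1).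
apply: csfun_eqP => p; rewrite csfunZE !csfunDE !csfunZE /form2 !csfun_ofE !sfunE.
have -> : (2 ^+ (1 + 1))^-1 = 2^-1 * 2^-1 :> R by rewrite addn1; field.
by apply/eqP; rewrite eq_complex /=; apply/andP; split; apply/eqP; field.
Qed.

Definition d1 a (X Y : V) : S := X (a Y) - Y (a X) - a (bracket X Y).
Definition d2 al (X Y Z : V) : S := X (al Y Z) - Y (al X Z) + Z (al X Y)
  - al (bracket X Y) Z + al (bracket X Z) Y + al X (bracket Y Z).

Lemma extd_form1 a b : extd 1 (form1 a b) = form2 (d1 a) (d1 b).
Proof.
apply/funext => X; rewrite /extd /form1.
rewrite !big_ord_recl !big_ord0 (big_mkcond (fun j : 'I_2 => (ord0 < j)%N))
  (big_mkcond (fun j : 'I_2 => (lift ord0 ord0 < j)%N)) !big_ord_recl !big_ord0 /=.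
rewrite /bump /= !(add0n, add1n, addn0, addr0, add0r) expr0 expr1 !cderiv_csfun_of.
apply: csfun_eqP => p; rewrite /form2 !csfunDE !csfunZE !csfun_ofE /d1 !sfunE.
by apply/eqP; rewrite eq_complex /=; apply/andP; split; apply/eqP; ring.
Qed.

Lemma extd_form2 al be : extd 2 (form2 al be) =
  fun X => csfun_of (d2 al (X 0) (X 1) (X 2)) (d2 be (X 0) (X 1) (X 2)).
Proof.
apply/funext => X; rewrite /extd /form2.
rewrite !big_ord_recl !big_ord0 (big_mkcond (fun j : 'I_3 => (ord0 < j)%N))
  (big_mkcond (fun j : 'I_3 => (lift ord0 ord0 < j)%N))
  (big_mkcond (fun j : 'I_3 => (lift ord0 (lift ord0 ord0) < j)%N)) !big_ord_recl !big_ord0 /=.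
rewrite /bump /= !(add0n, add1n, addn0, addr0, add0r) expr0 expr1 sqrrN expr1n !cderiv_csfun_of.
apply: csfun_eqP => p; rewrite !csfunDE !csfunZE !csfun_ofE /d2 !sfunE.
by apply/eqP; rewrite eq_complex /=; apply/andP; split; apply/eqP; ring.
Qed.

Lemma extd_form0 (om : form) (f h : S) : (forall X, om X = csfun_of f h) ->
  extd 0 om = form1 (fun X => X f) (fun X => X h).
Proof.
move=> omE; apply/funext => X; rewrite /extd /form1 !big_ord1 big_mkcond big_ord1 /= addr0.
by rewrite omE cderiv_csfun_of expr0 scale1r.
Qed.

End SmallForms.

(** * Exterior derivatives in degrees one and two, Lie derivatives of parallel tensors *)

Section ExteriorDerivative.
Context {R : realType} {n : nat} {M : manifold R n}.
Local Notation S := (sfun M).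
Local Notation V := (vfield M).
Implicit Types (X Y Z W : V).

Lemma bracketE X Y (f : S) : bracket X Y f = X (Y f) - Y (X f).
Proof. by []. Qed.

Lemma bracket_jacobi X Y Z :
  bracket (bracket X Y) Z - bracket (bracket X Z) Y - bracket X (bracket Y Z) = 0.
Proof.
apply: vfield_eqP => f; apply: sfun_eqP => p.
rewrite !(vfieldDE, vfieldNE, bracketE, vfB) !sfunE; ring.
Qed.

(** The second derivatives of the values of [a] cancel by the definition of the bracket; what is
    left is [a] of the Jacobi identity. *)
Lemma d2_d1 (a : V -> S) X Y Z : slinear a -> d2 (d1 a) X Y Z = 0.
Proof.
move=> la; have := congr1 a (bracket_jacobi X Y Z).
rewrite !slinearB// slinear0// => jac; apply: sfun_eqP => p.
have {jac} := congr1 (fun f : S => f p) jac; rewrite /d2 /d1 !vfB !bracketE !sfunE.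
lra.
Qed.

Lemma d1_antisym (a : V -> S) X Y : slinear a -> d1 a X Y = - d1 a Y X.
Proof.
move=> la; have -> : d1 a X Y = X (a Y) - Y (a X) - a (bracket X Y) by [].
have -> : bracket X Y = - bracket Y X.
  by apply: vfield_eqP => f; rewrite vfieldNE !bracketE opprB.
by rewrite slinearN// /d1; apply: sfun_eqP => p; rewrite !sfunE; ring.
Qed.

Lemma d1_differential (f : S) X Y : d1 (fun X => X f) X Y = 0.
Proof. by rewrite /d1 bracketE subrr. Qed.

Lemma d1Z (c : R) (a : V -> S) X Y : d1 (fun X => c *: a X) X Y = c *: d1 a X Y.
Proof. by rewrite /d1 !vfZ !scalerBr. Qed.

Lemma d1B (a b : V -> S) X Y : d1 (fun X => a X - b X) X Y = d1 a X Y - d1 b X Y.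
Proof. by rewrite /d1 !vfB; apply: sfun_eqP => p; rewrite !sfunE; ring. Qed.

Lemma parallel_closed (D : V -> V -> V) (al : V -> V -> S) X Y Z :
  (forall X Y, D X Y - D Y X = bracket X Y) -> is_2form al ->
  (forall W X Y, W (al X Y) = al (D W X) Y + al X (D W Y)) -> d2 al X Y Z = 0.
Proof.
move=> tor al2 par; rewrite /d2 -!tor.
rewrite !(slinearB _ _ (two_linear al2 _)) !(slinearB _ _ (two_linear_r _ al2)) !par.
rewrite (two_antisym al2 Y (D X Z)).
by apply: sfun_eqP => p; rewrite !sfunE; ring.
Qed.

(** Differentiate the parallelism of [tau] along [W] in the direction [v]. Affineness rewrites each
    bracket of [v] with a covariant derivative, and the terms in [bracket v W] cancel by parallelism
    along that field. *)
Lemma lie_parallel (D : V -> V -> V) (v : V) (tau : V -> V -> S) W X Y :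
  (forall Z, slinear (tau^~ Z)) -> (forall Z, slinear (tau Z)) ->
  (forall W X Y, W (tau X Y) = tau (D W X) Y + tau X (D W Y)) -> is_affine D v ->
  W (lie_metric v tau X Y) = lie_metric v tau (D W X) Y + lie_metric v tau X (D W Y).
Proof.
move=> ll lr par aff.
have A Z1 Z2 : tau (bracket v (D W Z1)) Z2 = tau (D (bracket v W) Z1) Z2 + tau (D W (bracket v
  Z1)) Z2.
  by rewrite aff (slinearD _ _ (ll Z2)).
have B Z1 Z2 : tau Z1 (bracket v (D W Z2)) = tau Z1 (D (bracket v W) Z2) + tau Z1 (D W (bracket v
  Z2)).
  by rewrite aff (slinearD _ _ (lr Z1)).
have C : v (W (tau X Y)) - W (v (tau X Y)) = tau (D (bracket v W) X) Y + tau X (D (bracket v W)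
  Y).
  by rewrite -bracketE par.
have C' := congr1 (fun f : S => v f) (par W X Y); rewrite vfD in C'.
rewrite /lie_metric !vfB A B.
rewrite (par W (bracket v X)) (par W X (bracket v Y)).
apply: sfun_eqP => p; have := congr1 (fun f : S => f p) C; have := congr1 (fun f : S => f p) C'.
by rewrite !sfunE; lra.
Qed.

End ExteriorDerivative.

(** * Affine vector fields *)

Section PseudoKahlerAffine.
Context {R : realType} {n : nat} {M : manifold R n}.
Local Notation S := (sfun M).
Local Notation V := (vfield M).
Variables (g : V -> V -> S) (D : V -> V -> V) (J : {linear V -> V}) (v : V).
Hypotheses (K : is_pseudo_kahler g D J) (aff : is_affine D v).
Implicit Types (X Y Z W : V).

Let LC := kahler_connection K.

Let gC X Y : g X Y = g Y X := metric_sym (kahler_metric K) X Y.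

Let gl Z : slinear (g^~ Z).
Proof. by move=> u X Y; exact: (metric_linear (kahler_metric K)). Qed.

Let gr Z : slinear (g Z).
Proof. by move=> u X Y; rewrite gC gl !(gC _ Z). Qed.

Let JJ X : J (J X) = - X := kahler_almost_complex K X.
Let JD X Y : D X (J Y) = J (D X Y) := kahler_parallel K X Y.

Let slinear_J (T : V -> S) : slinear T -> slinear (fun X => T (J X)).
Proof. by move=> lT u X Y; rewrite linearP lT. Qed.

Let gJ X Y : g (J X) Y = - g X (J Y).
Proof. by rewrite -(kahler_hermitian K X (J Y)) JJ (slinearN _ (gr _)) opprK. Qed.

Let gJJ X Y : g (J X) (J Y) = g X Y := kahler_hermitian K X Y.

Let tor X Y : D X Y - D Y X = bracket X Y := connection_torsion_free LC X Y.
Let gpar W X Y : W (g X Y) = g (D W X) Y + g X (D W Y) := connection_metric LC W X Y.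

Let omega X Y := g (J X) Y.
Let omega_l Z : slinear (omega^~ Z). Proof. exact: (slinear_J (gl Z)). Qed.
Let omega_r Z : slinear (omega Z). Proof. exact: gr. Qed.
Let omega_par W X Y : W (omega X Y) = omega (D W X) Y + omega X (D W Y).
Proof. by rewrite /omega gpar JD. Qed.

Let h := lie_metric v g.
Let eta := lie_metric v omega.
(** As [g v] is [lambda] composed with [J], the (1,0)- and (0,1)-parts of [lambda] have exterior
    derivatives [(eta - i kappa) / 2] and [(eta + i kappa) / 2]. *)
Let kappa := d1 (g v).

Let slinear_Dv (T : V -> S) : slinear T -> slinear (fun X => T (D X v)).
Proof. by move=> lT u X Y; rewrite (connection_linear LC) lT. Qed.

Let bracket_v X : bracket v X = D v X - D X v.
Proof. by rewrite tor. Qed.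

Let hE X Y : h X Y = g (D X v) Y + g X (D Y v).
Proof.
rewrite /h /lie_metric !bracket_v gpar (slinearB _ _ (gl Y)) (slinearB _ _ (gr X)).
by apply: sfun_eqP => p; rewrite !sfunE; ring.
Qed.

Let etaE X Y : eta X Y = g (J (D X v)) Y - g (J (D Y v)) X.
Proof.
rewrite /eta /lie_metric !bracket_v omega_par (slinearB _ _ (omega_l Y)) (slinearB _ _ (omega_r
  X)).
rewrite /omega (gJ (D Y v)) (gC (D Y v)).
by apply: sfun_eqP => p; rewrite !sfunE; ring.
Qed.

Let kappaE X Y : kappa X Y = g (D X v) Y - g (D Y v) X.
Proof.
rewrite /kappa /d1 -tor !gpar (slinearB _ _ (gr v)).
by apply: sfun_eqP => p; rewrite !sfunE; ring.
Qed.

(* Cartan's formula, for the closed form [omega]. *)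
Let eta_d1 X Y : d1 (g (J v)) X Y = eta X Y.
Proof.
rewrite etaE /d1 -tor !gpar (slinearB _ _ (gr _)) !JD.
by apply: sfun_eqP => p; rewrite !sfunE; ring.
Qed.

Let eta_par W X Y : W (eta X Y) = eta (D W X) Y + eta X (D W Y).
Proof. exact: lie_parallel. Qed.

Let h_par W X Y : W (h X Y) = h (D W X) Y + h X (D W Y).
Proof. exact: lie_parallel. Qed.

Let eta2 : is_2form eta.
Proof.
split=> [Z u X Y|X Y]; last by rewrite !etaE opprB.
by rewrite !etaE (slinear_Dv (slinear_J (gl Z))) gr; apply: sfun_eqP => p; rewrite !sfunE; ring.
Qed.

Let kappa2 : is_2form kappa.
Proof.
split=> [Z u X Y|X Y]; last by rewrite !kappaE opprB.
by rewrite !kappaE (slinear_Dv (gl Z)) gr; apply: sfun_eqP => p; rewrite !sfunE; ring.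
Qed.

Let h_sym X Y : h X Y = h Y X.
Proof. by rewrite !hE addrC (gC X) (gC _ Y). Qed.

Let h_l Z : slinear (h^~ Z).
Proof.
by move=> u X Y; rewrite !hE (slinear_Dv (gl Z)) gl; apply: sfun_eqP => p; rewrite !sfunE; ring.
Qed.

(* Integrability of [J]: the (2,0)-part of [d] of a (0,1)-form vanishes. *)
Let kappa_J X Y : kappa X Y - kappa (J X) (J Y) = eta X (J Y) + eta (J X) Y.
Proof.
rewrite !kappaE !etaE !gJJ (gJ (D (J X) v)) (gJ (D (J Y) v)).
by apply: sfun_eqP => p; rewrite !sfunE; ring.
Qed.

Let form2_eq al be al' be' : (forall X Y, al X Y = al' X Y :> S) ->
  (forall X Y, be X Y = be' X Y :> S) -> form2 al be = form2 al' be'.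
Proof. by move=> e1 e2; apply/funext => X; rewrite /form2 e1 e2. Qed.

Let form1_eq a b a' b' : (forall X, a X = a' X :> S) -> (forall X, b X = b' X :> S) ->
  form1 a b = form1 a' b'.
Proof. by move=> e1 e2; apply/funext => X; rewrite /form1 e1 e2. Qed.

Let two_J al : is_2form al -> is_2form (fun X Y => al (J X) (J Y)).
Proof.
by move=> [lin anti]; split=> [Z|X Y]; [exact: (slinear_J (lin (J Z)))|exact: anti].
Qed.

Let slinearZc (c : R) (T : V -> S) : slinear T -> slinear (fun X => c *: T X).
Proof. by move=> lT u X Y; rewrite lT; apply: sfun_eqP => p; rewrite !sfunE; ring. Qed.

Let two_Z (c : R) al : is_2form al -> is_2form (fun X Y => c *: al X Y).
Proof.
by move=> [lin anti]; split=> [Z|X Y]; [exact: slinearZc|rewrite anti scalerN].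
Qed.

Let two_D al be : is_2form al -> is_2form be -> is_2form (fun X Y => al X Y + be X Y).
Proof.
move=> [lin anti] [lin' anti']; split=> [Z u X Y|X Y]; last by rewrite anti anti' opprD.
by rewrite lin lin'; apply: sfun_eqP => p; rewrite !sfunE; ring.
Qed.

Let d2_0 al : (forall X Y Z, d2 al X Y Z = 0) -> forall be, (forall X Y Z, d2 be X Y Z = 0) ->
  extd 2 (form2 al be) = fun=> 0.
Proof.
move=> ha be hb; rewrite extd_form2; apply/funext => X; rewrite ha hb.
by apply: csfun_eqP.
Qed.

Let lam := g (J v).
Let lamJ X : lam (J X) = g v X. Proof. exact: gJJ. Qed.

Let gvJ X : g v (J X) = - lam X. Proof. by rewrite /lam gJ opprK. Qed.

Let etaNl X Y : eta (- X) Y = - eta X Y.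
Proof. exact: (slinearN _ (two_linear eta2 Y)). Qed.
Let etaNr X Y : eta X (- Y) = - eta X Y.
Proof. exact: (slinearN _ (two_linear_r X eta2)). Qed.
Let kappaNr X Y : kappa X (- Y) = - kappa X Y.
Proof. exact: (slinearN _ (two_linear_r X kappa2)). Qed.

Let kappa_J' X Y : kappa (J X) Y + kappa X (J Y) = eta (J X) (J Y) - eta X Y.
Proof.
have := kappa_J X (J Y); rewrite JJ kappaNr etaNr opprK addrC => ->.
by rewrite addrC.
Qed.

Hypothesis ddbar : ddbar_property J.

Let eta_type : forall X Y, eta (J X) (J Y) = eta X Y /\ eta (J X) Y = - eta X (J Y).
Proof.
(* [al] and [be] are the real and imaginary parts of the (2,0)-part of [eta]. *)
pose al X Y : S := 4^-1 *: (eta X Y + -1 *: eta (J X) (J Y)).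
pose be X Y : S := - 4^-1 *: (eta (J X) Y + eta X (J Y)).
have al2 : is_2form al by apply/two_Z/two_D => //; exact/two_Z/two_J.
have be2 : is_2form be.
  apply: two_Z; split=> [Z u X Y|X Y].
    rewrite (slinear_J (two_linear eta2 Z)) (two_linear eta2).
    by apply: sfun_eqP => p; rewrite !sfunE; ring.
  by rewrite opprD -!(two_antisym eta2) addrC.
pose la10 := form1 (fun X => 2^-1 *: lam X) (fun X => - 2^-1 *: g v X).
have p10 : is_pqform J 1 0 la10.
  split; first by apply: is_form1; apply: slinearZc; exact: gr.
  rewrite type_proj_10; apply: form1_eq => X.
    rewrite gvJ; apply: sfun_eqP => p; rewrite !sfunE; by field.
  rewrite /= lamJ; apply: sfun_eqP => p; rewrite !sfunE; by field.
have del10 : del J 1 0 la10 = form2 al be.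
  (* The projection of [(eta - i kappa) / 2] contains [kappa] only in the combinations that
     [kappa_J] and [kappa_J'] turn into [eta], which doubles the contribution of [eta]. *)
  rewrite /del /la10 (extd_form1 _ _) type_proj_20; apply: form2_eq => X Y;
    rewrite !d1Z /lam !eta_d1 -/kappa /al /be; apply: sfun_eqP => p.
    by have := congr1 (fun f : S => f p) (kappa_J' X Y); rewrite !sfunE; lra.
  by have := congr1 (fun f : S => f p) (kappa_J X Y); rewrite !sfunE; lra.
have closed20 : extd (2 + 0) (form2 al be) = fun=> 0.
  have pal W X Y : W (al X Y) = al (D W X) Y + al X (D W Y).
    by rewrite /al vfZ vfD vfZ !eta_par !JD; apply: sfun_eqP => p; rewrite !sfunE; ring.
  have pbe W X Y : W (be X Y) = be (D W X) Y + be X (D W Y).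
    by rewrite /be vfZ vfD !eta_par !JD; apply: sfun_eqP => p; rewrite !sfunE; ring.
  by apply: d2_0 => X Y Z; [exact: (parallel_closed _ _ _ tor al2 pal)|exact: (parallel_closed _
    _ _ tor be2 pbe)].
have p20 : is_pqform J 2 0 (form2 al be).
  split; first exact: is_form2.
  rewrite type_proj_20; apply: form2_eq => X Y; rewrite /al /be !JJ ?etaNl ?etaNr ?etaNl ?etaNr;
    by apply: sfun_eqP => p; rewrite !sfunE; field.
(* In bidegree (2,0) this says by definition that the form is zero, there being no (1,-1)-forms. *)
have : deldelbar_exact J 2 0 (form2 al be).
  by apply: ddbar p20 closed20 _; left; exists la10.
move=> /= /(congr1 (fun om : form => om)) e0.
have z : form2 al be = form2 (fun _ _ => 0) (fun _ _ => 0).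
  by rewrite e0; apply/funext => X; apply: csfun_eqP.
move=> X Y; have [a0 b0] := form2_inj z X Y; split; apply: sfun_eqP => p.
  by have := congr1 (fun f : S => f p) a0; rewrite /al !sfunE; lra.
by have := congr1 (fun f : S => f p) b0; rewrite /be !sfunE; lra.
Qed.

Let eta_JJ X Y : eta (J X) (J Y) = eta X Y. Proof. by have [] := eta_type X Y. Qed.
Let eta_J X Y : eta (J X) Y = - eta X (J Y). Proof. by have [] := eta_type X Y. Qed.

Let kappa_JJ X Y : kappa (J X) (J Y) = kappa X Y.
Proof.
by apply/esym/eqP; rewrite -subr_eq0 kappa_J eta_J subrr.
Qed.

Let eta_potential : exists f : S, forall X,
  eta X (J X) = X (X f) + J X (J X f) + J (bracket X (J X)) f.
Proof.
pose al X Y : S := 2^-1 *: eta X Y.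
pose be X Y : S := 2^-1 *: kappa X Y.
have al2 : is_2form al by exact: two_Z.
have be2 : is_2form be by exact: two_Z.
pose la01 := form1 (fun X => 2^-1 *: lam X) (fun X => 2^-1 *: g v X).
have p01 : is_pqform J 0 1 la01.
  split; first by apply: is_form1; apply: slinearZc; exact: gr.
  rewrite type_proj_01; apply: form1_eq => X.
    rewrite gvJ; apply: sfun_eqP => p; rewrite !sfunE; by field.
  rewrite /= lamJ; apply: sfun_eqP => p; rewrite !sfunE; by field.
have P11 : type_proj J 1 1 (form2 al be) = form2 al be.
  rewrite type_proj_11; apply: form2_eq => X Y; rewrite /al /be ?eta_JJ ?kappa_JJ;
    by apply: sfun_eqP => p; rewrite !sfunE; field.
have del01 : del J 0 1 la01 = form2 al be.
  rewrite -P11 /del /la01 (extd_form1 _ _); congr type_proj.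
  by apply: form2_eq => X Y; rewrite !d1Z /lam ?eta_d1.
have closed11 : extd (1 + 1) (form2 al be) = fun=> 0.
  have dal X Y Z : d2 al X Y Z = 0.
    apply: (parallel_closed _ _ _ tor al2) => W X' Y'.
    by rewrite /al vfZ eta_par; apply: sfun_eqP => p; rewrite !sfunE; ring.
  apply: d2_0 => X Y Z //.
  have -> : be = d1 (fun X => 2^-1 *: g v X).
    by apply/funext => X'; apply/funext => Y'; rewrite d1Z.
  by apply: d2_d1; apply: slinearZc; exact: gr.
have : deldelbar_exact J 1 1 (form2 al be).
  apply: ddbar closed11 _; first by split=> //; exact: is_form2.
  by left; exists la01.
move=> [la [la0 _]]; pose F := la (fun=> 0).
pose f := re_sfun F; pose k := im_sfun F.
have laE (X : nat -> V) : la X = csfun_of f k.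
  (* A 0-form reads none of its arguments, so it is a single function. *)
  have -> : la X = F by exact: (form_local la0).
  apply: csfun_eqP => p.
  by rewrite csfun_ofE /=; case: (F p).
rewrite /del /delbar (extd_form0 laE) type_proj_01 (extd_form1 _ _) type_proj_11 => e.
exists k => X; have [e1 _] := form2_inj e X (J X); move: e1.
rewrite /al JJ; set a1 := (fun X => 2^-1 *: (X f - J X k)).
have la1 : slinear a1.
  by move=> u Y Z; rewrite /a1 linearP; apply: sfun_eqP => p;
    rewrite !(vfieldDE, vfieldZE) !sfunE; ring.
have a1N Y Z : d1 a1 Y (- Z) = - d1 a1 Y Z.
  rewrite /d1 (slinearN _ la1) vfN.
  have -> : bracket Y (- Z) = - bracket Y Z.
    by apply: vfield_eqP => f'; rewrite !(vfieldNE, bracketE) vfN; apply: sfun_eqP => p;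
      rewrite !sfunE; ring.
  by rewrite (slinearN _ la1) vfieldNE; apply: sfun_eqP => p; rewrite !sfunE; ring.
(* On the pair [X, J X] the two terms of the (1,1)-projection coincide. The differential of [f] is
   closed and drops out, leaving [d] of [X |-> J X k]. *)
rewrite a1N -(d1_antisym _ _ la1) /a1 d1Z d1B d1_differential /d1 JJ vfieldNE vfN => e1.
apply: sfun_eqP => p; have := congr1 (fun f : S => f p) e1.
by rewrite !sfunE; lra.
Qed.

(** * Vanishing of [eta] by comparison at extrema, and the quadratic differential *)

Hypotheses (cM : compact [set: M]) (conM : connected [set: M]).

Let b X Y := eta X (J Y).

Let b_sym X Y : b X Y = b Y X.
Proof. by rewrite /b (two_antisym eta2) eta_J opprK. Qed.

Let b_l Z : slinear (b^~ Z). Proof. exact: two_linear eta2 (J Z). Qed.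

Let b_par W X Y : W (b X Y) = b (D W X) Y + b X (D W Y).
Proof. by rewrite /b eta_par JD. Qed.

Let b_eq0 X Y p : b X Y p = 0.
Proof.
have [f fP] := eta_potential.
have [pmax fmax] := sfun_exists_max f p cM.
have [pmin fmin] := sfun_exists_max (- f) p cM.
have Dadd Z Y1 Y2 : D Z (Y1 + Y2) = D Z Y1 + D Z Y2 := connection_add LC Z Y1 Y2.
have Dleib u Z Y' : D Z (u *: Y') = Z u *: Y' + u *: D Z Y' := connection_leibniz LC u Z Y'.
have le0 : forall q Z, b Z Z q <= 0.
  apply: (parallel_nonpos conM Dadd Dleib b_sym b_l b_par) => Z.
  rewrite /b fP !sfunE; have [_ h1] := sfun_max_second_derivative fmax Z.
  have [_ h2] := sfun_max_second_derivative fmax (J Z).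
  have [h3 _] := sfun_max_second_derivative fmax (J (bracket Z (J Z))).
  by move: h1 h2 h3; lra.
(* The same argument for the parallel form [- b], started at a maximum of [- f]. *)
have ge0 : forall q Z, - b Z Z q <= 0.
  have nb_sym X' Y' : - b X' Y' = - b Y' X' by rewrite b_sym.
  have nb_l Z : slinear (fun X => - b X Z).
    by move=> u X' Y'; rewrite b_l; apply: sfun_eqP => q; rewrite !sfunE; ring.
  have nb_par W X' Y' : W (- b X' Y') = - b (D W X') Y' + - b X' (D W Y').
    by rewrite vfN b_par opprD.
  apply: (parallel_nonpos conM Dadd Dleib nb_sym nb_l nb_par) => Z.
  rewrite /b fP !sfunE; have [_] := sfun_max_second_derivative fmin Z.
  have [_] := sfun_max_second_derivative fmin (J Z).
  have [] := sfun_max_second_derivative fmin (J (bracket Z (J Z))).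
  by rewrite !vfN !sfunE; lra.
have z Z : b Z Z p = 0 by have := le0 p Z; have := ge0 p Z; lra.
have bD X1 X2 Z : b (X1 + X2) Z = b X1 Z + b X2 Z by exact: (slinearD _ _ (b_l Z)).
(* Polarization: the quadratic form vanishes, hence so does the symmetric form. *)
have e : b (X + Y) (X + Y) = b X X + b Y Y + (b X Y + b X Y).
  rewrite bD (b_sym X (X + Y)) (b_sym Y (X + Y)) !bD (b_sym Y X).
  by apply: sfun_eqP => q; rewrite !sfunE; ring.
have ep : b (X + Y) (X + Y) p = b X X p + b Y Y p + (b X Y p + b X Y p) by rewrite e.
by rewrite !z in ep; lra.
Qed.

Let eta0 X Y : eta X Y = 0.
Proof.
apply: sfun_eqP => p; have := b_eq0 X (J Y) p; rewrite /b JJ etaNr !sfunE.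
by move=> /eqP; rewrite oppr_eq0 => /eqP.
Qed.

(** The vanishing of [eta] says that [g (J (D X v)) Y] is symmetric in [X] and [Y]. With [g]
    Hermitian, each of the two terms of [h (J X) Y] then equals the other term of [h X (J Y)]. *)
Let h_J X Y : h (J X) Y = h X (J Y).
Proof.
have N_sym X' Y' : g (J (D X' v)) Y' = g (J (D Y' v)) X'.
  by apply/eqP; rewrite -subr_eq0 -etaE eta0.
have e1 : g (D (J X) v) Y = g X (D (J Y) v) by rewrite -gJJ N_sym gJJ gC.
have e2 : g (J X) (D Y v) = g (D X v) (J Y).
  by rewrite gC -[LHS]opprK -gJ N_sym gJ opprK.
by rewrite !hE e1 e2 addrC.
Qed.

Let theta X Y : csfun M := csfun_of (h X Y) (- h (J X) Y).

Let theta_holomorphic : is_holomorphic_quadratic J theta.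
Proof.
have h_r Z : slinear (h Z) by move=> u X Y; rewrite h_sym h_l !(h_sym _ Z).
split.
- by move=> X Y; rewrite /theta h_sym h_J (h_sym X).
- move=> u X Y Z p; rewrite /theta linearP !h_l complex_axpy csfun_ofE; congr Complex.
  by rewrite !sfunE; ring.
- move=> X Y; apply: csfun_eqP => p; rewrite csfunZE !csfun_ofE JJ (slinearN _ (h_l Y)) !sfunE.
  by apply/eqP; rewrite eq_complex /=; apply/andP; split; apply/eqP; ring.
- move=> U w w' oU holw holw' X p Up.
  (* Expanding the brackets by torsion-freeness, the derivatives along [u] cancel since [J] is
     parallel. So the covariant derivative of a real-holomorphic field is complex-linear in its
     direction, on [U] only; [tens] transfers this to tensor values at [p]. *)
  have DJ u : real_holomorphic_on J U u -> forall q, U q -> vanishes_at (J (D X u) - D (J X) u) q.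
    move=> hol q Uq f; have := hol X q Uq f; rewrite -!tor JD linearB.
    rewrite !(vfieldDE, vfieldNE) !sfunE; lra.
  have tens T u : slinear T -> real_holomorphic_on J U u -> T (D (J X) u) p = T (J (D X u)) p.
    move=> lT /DJ van; have := slinear_local lT oU Up van.
    by rewrite (slinearB _ _ lT) sfunBE => /eqP; rewrite subr_eq0 => /eqP.
  have h_parp W X' Y' : W (h X' Y') p = h (D W X') Y' p + h X' (D W Y') p by rewrite h_par.
  have t1 : h (D (J X) w) w' p = h (J (D X w)) w' p := tens _ w (h_l w') holw.
  have t2 : h w (D (J X) w') p = h w (J (D X w')) p := tens _ w' (h_r w) holw'.
  have t3 : h (J (D (J X) w)) w' p = - h (D X w) w' p.
    by rewrite (tens _ w (slinear_J (h_l w')) holw) JJ (slinearN _ (h_l w')).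
  have t4 : h (J w) (D (J X) w') p = - h w (D X w') p.
    by rewrite (tens _ w' (h_r (J w)) holw') h_J JJ (slinearN _ (h_r w)).
  (* [D1] and [D2] are the Cauchy-Riemann equations for the function with real part [h w w'] and
     imaginary part [- h (J w) w']. *)
  have D1 : J X (h w w') p = X (h (J w) w') p.
    by rewrite !h_parp JD t1 t2 (h_J w).
  have D2 : J X (h (J w) w') p = - X (h w w') p.
    by rewrite !h_parp JD t3 t4; ring.
  rewrite /theta !cderiv_csfun_of !csfun_ofE !vfN !sfunE D1 D2.
  by apply/eqP; rewrite eq_complex /=; apply/andP; split; apply/eqP; ring.
Qed.

Lemma lie_metric_quadratic_differential :
  exists2 th, is_holomorphic_quadratic J th &
    forall X Y p, lie_metric v g X Y p = complex.Re (th X Y p).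
Proof. by exists theta. Qed.

End PseudoKahlerAffine.

Theorem theorem6p2 (R : realType) (n : nat) (M : manifold R n)
    (g : vfield M -> vfield M -> sfun M)
    (nabla : vfield M -> vfield M -> vfield M)
    (J : {linear vfield M -> vfield M}) (v : vfield M) :
  compact [set: M] -> connected [set: M] ->
  is_pseudo_kahler g nabla J -> ddbar_property J -> is_affine nabla v ->
  (exists2 theta : vfield M -> vfield M -> csfun M,
     is_holomorphic_quadratic J theta &
     forall (X Y : vfield M) (p : M),
       lie_metric v g X Y p = complex.Re (theta X Y p)) /\
  ((forall theta : vfield M -> vfield M -> csfun M,
      is_holomorphic_quadratic J theta -> forall X Y, theta X Y = 0) ->
   forall X Y : vfield M, lie_metric v g X Y = 0).
Proof.
move=> cM conM K ddbar aff.
have [theta hol hE] := lie_metric_quadratic_differential K aff ddbar cM conM.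
split; first by exists theta.
by move=> th0 X Y; apply: sfun_eqP => p; rewrite hE th0.
Qed.
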